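(* Suppose the random vector $(X,\kappa_A)$ is regularly varying with index $\alpha>1$ and non-null Radon measure $\mu$, and that $\mathbb{E}[\kappa_A]<1$. Let $H^{H}$ be the maximum of the transformed marks in a generic cluster of the Hawkes process, which satisfies $$H^{H}\overset{d}{=}X\vee\bigvee_{j=1}^{L_A}H^{H}_j .$$ Then $$\mathbb{P}(H^{H}>x)\sim\frac{1}{1-\mathbb{E}[\kappa_A]}\,\mathbb{P}(X>x),\qquad x\to\infty .$$ Moreover, if $\mu(\{(x_1,x_2)\in[0,\infty)^2\setminus\{(0,0)\}:x_1>1\})>0$, then $H^{H}$ is regularly varying with index $\alpha$.
   Context: Generic cluster of the Hawkes process: marks take values in a measurable space $\mathbb{A}$ and have common distribution $F$; $f:\mathbb{A}\to[0,\infty)$ is measurable; $h:(0,\infty)\times\mathbb{A}\to[0,\infty)$ is the fertility function and $\kappa_a=\int_0^\infty h(t,a)\,dt$. The cluster is a branching tree: the root (immigrant) has mark $A\sim F$; every individual with mark $a$ has, given its mark, a Poisson($\kappa_a$) number of children, whose marks are i.i.d. with law $F$ and independent of that number and of the parent's mark; different individuals reproduce independently given their marks. $X=f(A)$ and $L_A$ is the number of children of the root, so $L_A\mid A\sim\text{Poisson}(\kappa_A)$; $X$ and $L_A$ are dependent through $A$. $H^{H}$ is the maximum of $f(\text{mark})$ over all individuals in the tree (root included), and in the displayed equation $(H_j^{H})_{j\ge1}$ are i.i.d. copies of $H^{H}$ independent of $(X,L_A)$. The condition $\mathbb{E}[\kappa_A]<1$ (subcriticality) makes clusters almost surely finite.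 Notation: $f(x)\sim g(x)$ as $x\to\infty$ means $\lim_{x\to\infty} f(x)/g(x)=1$. Regular variation: a nonnegative random variable $Z$ is regularly varying with index $\alpha>0$ if $\mathbb{P}(Z>x)=x^{-\alpha}L(x)$ for $x>0$, with $L$ slowly varying at infinity. A random vector $\mathbf{X}$ in $\mathbb{R}^2$ is regularly varying with index $\alpha>0$ and non-null Radon measure $\mu$ if (for some norm $|\cdot|$) $|\mathbf{X}|$ is regularly varying with index $\alpha$ and, for a sequence $(a_n)$ with $n\mathbb{P}(|\mathbf{X}|>a_n)\to1$, the measures $n\mathbb{P}(a_n^{-1}\mathbf{X}\in\cdot)$ converge vaguely to $\mu$ on $\mathbb{R}^2\setminus\{(0,0)\}$, where $\mu$ is a non-null Radon measure (finite on Borel sets bounded away from the origin). *)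

(* Defs.v *)
From HB Require Import structures.
From mathcomp Require Export all_boot all_order all_algebra.
From mathcomp Require Export all_classical all_reals all_analysis.
(* not exported by all_analysis; needed for the sigma-algebra on \bar R *)
From mathcomp Require Export measurable_realfun.

Set Implicit Arguments.
Unset Strict Implicit.
Unset Printing Implicit Defensive.

Import Order.TTheory GRing.Theory Num.Theory.
Import numFieldNormedType.Exports.

Local Open Scope classical_set_scope.
Local Open Scope ring_scope.

(* f(x) ~ g(x) as x -> +oo, that is, f / g -> 1, where 0/0 counts as 1 (the
   division of the library would give 0); it matters only when f and g vanish
   at the same points x arbitrarily far out. *)
Definition asymp_equiv (R : realType) (f g : R -> R) : Prop :=
  (if (f x == 0) && (g x == 0) then 1 else f x / g x) @[x --> +oo] --> (1 : R).

Definition slowly_varying (R : realType) (L : R -> R) : Prop :=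
  [/\ measurable_fun (`]0, +oo[ : set R) L,
      \forall x \near +oo, 0 < L x &
      forall t, 0 < t -> L (t * x) / L x @[x --> +oo] --> (1 : R)].

Definition tail d (T : measurableType d) (R : realType) (P : probability T R)
    (Z : T -> \bar R) (x : R) : R :=
  fine (P [set w | (x%:E < Z w)%E]).

(* Random variables are allowed the value +oo on a null set, since the maximum
   of a cluster is a supremum that is only almost surely finite. *)
Definition regularly_varying d (T : measurableType d) (R : realType)
    (P : probability T R) (Z : T -> \bar R) (alpha : R) : Prop :=
  [/\ 0 < alpha,
      measurable_fun [set: T] Z,
      forall w, (0 <= Z w)%E,
      {ae P, forall w, Z w \is a fin_num} &
      exists2 L : R -> R, slowly_varying L &
        forall x, 0 < x -> tail P Z x = x `^ (- alpha) * L x].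

Definition is_norm (R : realType) (N : R * R -> R) : Prop :=
  [/\ forall v, N v = 0 -> v = 0,
      forall (c : R) v, N (c *: v) = `|c| * N v &
      forall u v, N (u + v) <= N u + N v].

Definition bounded_away (R : realType) (B : set (R * R)) : Prop :=
  exists2 e : R, 0 < e & forall z, B z -> e <= `|z|.

(* A measure on the punctured plane is represented by a measure on R * R that
   does not charge the origin. *)
Definition nonnull_radon_punctured (R : realType)
    (mu : {measure set (R * R) -> \bar R}) : Prop :=
  [/\ mu [set 0] = 0%E,
      forall B, measurable B -> bounded_away B -> (mu B < +oo)%E &
      (0 < mu [set: R * R])%E].

Definition vague_test (R : realType) (phi : R * R -> R) : Prop :=
  [/\ continuous phi,
      forall z, 0 <= phi z,
      exists M : R, forall z, phi z <= M &
      bounded_away [set z | phi z != 0]].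

(* The integral of phi against the measure n P(V / a_n \in .) is
   n E[phi(V / a_n)]. *)
Definition regularly_varying_vector d (T : measurableType d) (R : realType)
    (P : probability T R) (V : T -> R * R) (alpha : R)
    (mu : {measure set (R * R) -> \bar R}) : Prop :=
  [/\ measurable_fun [set: T] V,
      nonnull_radon_punctured mu &
      exists (N : R * R -> R) (a : nat -> R),
        [/\ is_norm N,
            regularly_varying P (fun w => (N (V w))%:E) alpha,
            n%:R * tail P (fun w => (N (V w))%:E) (a n) @[n --> \oo]
              --> (1 : R) &
            forall phi, vague_test phi ->
              (n%:R%:E * \int[P]_w (phi ((a n)^-1 *: V w))%:E)%E @[n --> \oo]
                --> (\int[mu]_z (phi z)%:E)%E]].

(* The sigma-algebra generated by Z. *)
Definition sigma_of d d' (T : measurableType d) (T' : measurableType d')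
    (Z : T -> T') : set (set T) :=
  preimage_set_system [set: T] Z measurable.

Definition mutually_independent d (T : measurableType d) (R : realType)
    (P : probability T R) (I : eqType) (G : I -> set (set T)) : Prop :=
  forall (s : seq I) (B : I -> set T),
    uniq s -> (forall i, i \in s -> G i (B i)) ->
    P (\bigcap_(i in [set` s]) B i) = (\prod_(i <- s) P (B i))%E.

Definition same_law d1 d2 d' (T1 : measurableType d1) (T2 : measurableType d2)
    (T' : measurableType d') (R : realType)
    (P : probability T1 R) (Y : T1 -> T')
    (Q : probability T2 R) (Z : T2 -> T') : Prop :=
  forall B : set T', measurable B -> P (Y @^-1` B) = Q (Z @^-1` B).

Definition kappa d (A : measurableType d) (R : realType)
    (h : R * A -> R) (a : A) : \bar R :=
  (\int[lebesgue_measure]_(t in `]0%R, +oo[) (h (t, a))%:E)%E.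

(* Ulam-Harris labels: [::] is the root, rcons u i the (i+1)-st child of u.
   Marks and numbers of children are attached to all labels; the cluster
   consists of the labels that are reached from the root. *)
Inductive in_cluster (nchild : seq nat -> nat) : seq nat -> Prop :=
| in_cluster_root : in_cluster nchild [::]
| in_cluster_child u i : in_cluster nchild u -> (i < nchild u)%N ->
    in_cluster nchild (rcons u i).

(* The pairs (mark, number of children) are i.i.d. over the labels, the mark
   having law F and the number of children being, given the mark a,
   Poisson(kappa a).  The second (nat) argument of poisson_prob is a dummy;
   poisson_prob is used rather than poisson_pmf because the latter is not the
   Dirac mass at 0 when the rate is 0.  If kappa a is infinite the rate is read
   as 0, which concerns only a null set of marks when E[kappa_A] < +oo. *)
Record hawkes_cluster d d' (A : measurableType d) (T : measurableType d')
    (R : realType) (F : probability A R) (h : R * A -> R)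
    (P : probability T R)
    (mark : seq nat -> T -> A) (nchild : seq nat -> T -> nat) : Prop := {
  measurable_mark : forall u, measurable_fun [set: T] (mark u) ;
  measurable_nchild : forall u, measurable_fun [set: T] (nchild u) ;
  mark_law : forall u (B : set A), measurable B -> P (mark u @^-1` B) = F B ;
  nchild_law : forall u (B : set A) (k : nat), measurable B ->
    P ((mark u @^-1` B) `&` (nchild u @^-1` [set k])) =
    (\int[F]_(a in B) poisson_prob (fine (kappa h a)) 0%N [set k])%E ;
  individuals_independent : mutually_independent P
    (fun u => sigma_of (fun w => (mark u w, nchild u w)))
}.

Definition cluster_max d d' (A : measurableType d) (T : measurableType d')
    (R : realType) (f : A -> R)
    (mark : seq nat -> T -> A) (nchild : seq nat -> T -> nat) (w : T) : \bar R :=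
  ereal_sup [set (f (mark u w))%:E | u in in_cluster (nchild^~ w)].

(* H =d X \/ max_(j < L) H_j, with (H_j) i.i.d. copies of H independent of
   (X, L): the equation holds for every realisation XL of the law of (X, L) and
   H_ of the copies, on any probability space. *)
Definition max_fixed_point d (T : measurableType d) (R : realType)
    (P : probability T R) (X : T -> R) (L : T -> nat) (H : T -> \bar R) : Prop :=
  forall d' (T' : measurableType d') (Q : probability T' R)
    (XL : T' -> R * nat) (H_ : nat -> T' -> \bar R),
    measurable_fun [set: T'] XL ->
    (forall j, measurable_fun [set: T'] (H_ j)) ->
    same_law P (fun w => (X w, L w)) Q XL ->
    (forall j, same_law P H Q (H_ j)) ->
    mutually_independent Q (fun i : option nat =>
      if i is Some j then sigma_of (H_ j) else sigma_of XL) ->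
    same_law P H Q (fun w =>
      maxe (XL w).1%:E (\big[maxe/-oo%E]_(j < (XL w).2) H_ j w)).

(* Main.v *)
From mathcomp Require Import ring lra.
Require Import Defs.
Import Order.TTheory GRing.Theory Num.Theory.
Import numFieldNormedType.Exports.
Local Open Scope classical_set_scope.
Local Open Scope ring_scope.

(** Write q(x) = P(H <= x) for the distribution function of the cluster maximum
    H, and G = 1 - q for its tail.

    Cutting the cluster at the root gives H = X \/ max_(j < L) H_j, where H_j is
    the maximum over the subtree of the (j+1)-st child of the root.  The event
    that all marks of a subtree are at most x depends only on the labels below
    the root of the subtree, so distinct subtrees are independent of each other
    and of the root ([sigma_join_independent]), and subtrees truncated at
    generation n have, by induction on n, the same law whatever their root
    ([probability_below_to]).  Hence
      q(x) = sum_k P(X <= x, L = k) q(x) ^ k     ([cluster_max_cdf]),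
    and the same formula, read for arbitrary independent copies, is the
    distributional equation ([cluster_max_fixed_point]).

    Since 1 - q ^ k = (1 - q) (1 + q + ... + q ^ (k - 1)), this becomes the exact
    relation
      G(x) (1 - M(x)) = P(X > x)     ([tail_recursion]),
    where M(x) is the mean of 1 + q(x) + ... + q(x) ^ (L - 1) on the event
    X <= x.  As M <= E[L] = E[kappa_A] < 1, the tail G is at most a constant
    times P(X > x) and tends to 0, so q(x) tends to 1; M(x) then increases to
    E[L] by monotone convergence, and G(x) / P(X > x) tends to
    1 / (1 - E[kappa_A]).

    For regular variation it thus remains to see that p(x) = P(X > x) is
    regularly varying when mu charges the half-plane x_1 > 1.  Testing the vague
    convergence against a ramp in the first coordinate that rises from 0 at 1
    to 1 at lambda > 1 gives a limit J, with 0 < J < +oo, such that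
      n p(lambda a_n) <= J + o(1)  and  n p(a_n) >= J - o(1).
    Comparing a_n with the quantiles of the regularly varying tail
    r(x) = P(|(X, kappa_A)| > x) turns this into bounds on p / r which, as lambda
    decreases to 1, show that log (p / r) has arbitrarily small oscillation at
    infinity ([regular_tail_compare]); this suffices for p to inherit the
    regular variation of r ([regular_tail_oscillation]). *)

Set Implicit Arguments.
Unset Strict Implicit.
Unset Printing Implicit Defensive.

(** * Independent families of sigma-algebras *)

Section independence.
Context d (T : measurableType d) (R : realType) (P : probability T R).

(** Both sides are finite measures in the argument [A], so agreement on a
    pi-system extends to the sigma-algebra that it generates. *)
Lemma independent_of_sigma (C : set (set T)) (D : set T) :
    C `<=` measurable -> measurable D -> setI_closed C -> C setT ->
    (forall A, C A -> P (A `&` D) = (P A * P D)%E) ->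
  forall A, <<s C >> A -> P (A `&` D) = (P A * P D)%E.
Proof.
move=> mC mD CI CT CD A CA.
have PD0 : 0 <= fine (P D) by rewrite fine_ge0.
have PDE : P D = (NngNum PD0)%:num%:E by rewrite /= fineK// fin_num_measure.
rewrite muleC PDE.
pose m1 : {measure set T -> \bar R} := mrestr P mD.
pose m2 : {measure set T -> \bar R} := mscale (NngNum PD0) P.
have := @g_sigma_algebra_measure_unique _ _ _ C mC (fun=> setT) _ _ m1 m2.
apply => //.
- by rewrite bigcup_const //; exists 0%N.
- by move=> B CB; rewrite /m1 /m2 /= /mrestr /mscale/= CD// muleC PDE.
- by move=> _; rewrite /m1 /= /mrestr setTI ltey_eq fin_num_measure.
Qed.

Context (I : choiceType) (G : I -> set (set T)).
Hypothesis GI : forall i, setI_closed (G i).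
Hypothesis GT : forall i, G i setT.
Hypothesis Gm : forall i, G i `<=` measurable.
Hypothesis indepG : mutually_independent P G.

Definition sigma_join (S : set I) : set (set T) :=
  <<s \bigcup_(i in S) G i >>.

Let cylinder (S : set I) : set (set T) :=
  [set C | exists (s : seq I) (B : I -> set T), [/\ uniq s,
    forall i, i \in s -> S i /\ G i (B i) &
    C = \bigcap_(i in [set` s]) B i]].

Let cylinderI S : setI_closed (cylinder S).
Proof.
move=> _ _ [s [B [us sB ->]]] [s' [B' [us' sB' ->]]].
exists (undup (s ++ s')), (fun i => (if i \in s then B i else setT) `&`
  (if i \in s' then B' i else setT)); split; first exact: undup_uniq.
  move=> i; rewrite mem_undup mem_cat => /orP is_.
  split; first by case: is_ => [/sB[]|/sB'[]].
  by apply: GI; [case: ifPn => // /sB[] | case: ifPn => // /sB'[]].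
apply/seteqP; split => [x [sx s'x] i /=|x sx].
  by move=> _; split; case: ifPn => // is_; [exact: sx|exact: s'x].
by split => i /= is_; have /(_ _)/= := sx i; rewrite mem_undup mem_cat is_ ?orbT => -[].
Qed.

Let cylinderT S : cylinder S setT.
Proof.
by exists [::], (fun=> setT); split => //; apply/seteqP; split.
Qed.

Let cylinder_measurable S : cylinder S `<=` measurable.
Proof.
move=> _ [s [B [us sB ->]]].
by apply: fin_bigcap_measurable => [|i /= /sB[_] /Gm].
Qed.

Let cylinder_indep S S' C C' : S `&` S' = set0 ->
  cylinder S C -> cylinder S' C' -> P (C `&` C') = (P C * P C')%E.
Proof.
move=> SS' [s [B [us sB ->]]] [s' [B' [us' sB' ->]]].
have disj i : i \in s' -> i \in s = false.
  move=> /sB'[S'i _]; apply/negP => /sB[Si _].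
  by have : (S `&` S') i by []; rewrite SS'.
pose B2 i := if i \in s then B i else B' i.
have -> : \bigcap_(i in [set` s]) B i `&` \bigcap_(i in [set` s']) B' i =
    \bigcap_(i in [set` s ++ s']) B2 i.
  apply/seteqP; split => [x [sx s'x] i /=|x sx].
    by rewrite mem_cat /B2; case: ifPn => //= [/sx//|_ /s'x].
  split => i /= is_; have /(_ _)/= := sx i; rewrite mem_cat is_ ?orbT/B2.
    by rewrite is_; exact.
  by rewrite disj//; exact.
rewrite !indepG//.
- rewrite big_cat/=; congr (_ * _)%E; apply: eq_big_seq => i is_; rewrite /B2.
    by rewrite is_.
  by rewrite disj.
- by move=> i /sB'[].
- by move=> i /sB[].
- rewrite cat_uniq us us' andbT/=; apply/hasPn => i /disj.
  by move=> /= ->.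
- move=> i; rewrite mem_cat /B2; case: ifPn => [/sB[]//|_ /= /sB'[]//].
Qed.

Let sigma_join_sub S C : sigma_join S C -> <<s cylinder S >> C.
Proof.
apply: sub_sigma_algebra2 => B [i Si GB]; exists [:: i], (fun=> B); split => //.
  by move=> j; rewrite inE => /eqP ->.
by apply/seteqP; split => [x Bx j _//|x]; apply => /=; rewrite inE.
Qed.

Lemma sigma_join_measurable S : sigma_join S `<=` measurable.
Proof.
apply: smallest_sub; first exact: sigma_algebra_measurable.
by move=> B [i _ /Gm].
Qed.

(** Grouping: on the pi-systems of finite intersections of events taken from
    distinct [G i], the product rule is the assumption on [G].  Extending it one
    side at a time by [independent_of_sigma] yields the generated
    sigma-algebras. *)
Lemma sigma_join_independent S S' C C' : S `&` S' = set0 ->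
  sigma_join S C -> sigma_join S' C' -> P (C `&` C') = (P C * P C')%E.
Proof.
move=> SS' SC S'C'.
apply: (@independent_of_sigma (cylinder S) C') => //.
- exact: sigma_join_measurable S'C'.
- move=> A SA; rewrite setIC muleC.
  apply: (@independent_of_sigma (cylinder S') A) => //.
  + exact: cylinder_measurable SA.
  + move=> A' S'A'; rewrite setIC muleC; exact: (cylinder_indep SS' SA S'A').
  + exact: sigma_join_sub.
- exact: sigma_join_sub.
Qed.

Lemma sigma_join_subset S S' : S `<=` S' -> sigma_join S `<=` sigma_join S'.
Proof. by move=> SS'; apply: sub_sigma_algebra2; exact: bigcup_subset. Qed.

Lemma sub_sigma_join S i B : S i -> G i B -> sigma_join S B.
Proof. by move=> Si GB; apply: sub_sigma_algebra; exists i. Qed.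

End independence.


Lemma sigma_join_bigcap d (T : measurableType d) (I : choiceType) (J : Type)
    (G : I -> set (set T)) (S : set I) (B : J -> set T) :
  countable [set: J] -> (forall j, sigma_join G S (B j)) ->
  sigma_join G S (\bigcap_j B j).
Proof.
move=> cJ SB; rewrite -[X in sigma_join _ _ X]setCK setC_bigcap.
pose T' := g_sigma_algebraType (\bigcup_(i in S) G i).
apply: (@measurableC _ T'); apply: (@countable_bigcupT_measurable _ T') => // j.
exact: (@measurableC _ T' _ (SB j)).
Qed.

Lemma sigma_joinU d (T : measurableType d) (I : choiceType)
    (G : I -> set (set T)) (S : set I) (B C : set T) :
  sigma_join G S B -> sigma_join G S C -> sigma_join G S (B `|` C).
Proof.
exact: (@measurableU _ (g_sigma_algebraType (\bigcup_(i in S) G i))).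
Qed.

Lemma sigma_joinC d (T : measurableType d) (I : choiceType)
    (G : I -> set (set T)) (S : set I) (B : set T) :
  sigma_join G S B -> sigma_join G S (~` B).
Proof.
exact: (@measurableC _ (g_sigma_algebraType (\bigcup_(i in S) G i))).
Qed.

Lemma sigma_joinT d (T : measurableType d) (I : choiceType)
    (G : I -> set (set T)) (S : set I) : sigma_join G S setT.
Proof.
exact: (@measurableT _ (g_sigma_algebraType (\bigcup_(i in S) G i))).
Qed.
(** * The branching structure of the cluster *)

Section sigma_of.
Context d d' (T : measurableType d) (T' : measurableType d') (Z : T -> T').

Lemma sigma_ofI : setI_closed (sigma_of Z).
Proof.
move=> _ _ [B mB <-] [C mC <-]; exists (B `&` C); first exact: measurableI.
by rewrite !setTI.
Qed.

Lemma sigma_ofT : sigma_of Z setT.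
Proof. by exists setT => //; rewrite preimage_setT setTI. Qed.

Lemma preimage_sigma_of B : measurable B -> sigma_of Z (Z @^-1` B).
Proof. by move=> mB; exists B => //; rewrite setTI. Qed.

Lemma sigma_of_measurable :
  measurable_fun [set: T] Z -> sigma_of Z `<=` measurable.
Proof. by move=> mZ _ [B mB <-]; exact: mZ. Qed.

End sigma_of.

Lemma probability_random_bigcap d (T : measurableType d) (R : realType)
    (P : probability T R) (D : set T) (K : T -> nat) (E : nat -> set T) :
    measurable D -> measurable_fun [set: T] K -> (forall j, measurable (E j)) ->
  P (D `&` [set w | forall j, (j < K w)%N -> E j w]) =
  (\sum_(0 <= k <oo) P ((D `&` K @^-1` [set k]) `&` \bigcap_(j < k) E j))%E.
Proof.
move=> mD mK mE.
have mDk k : measurable ((D `&` K @^-1` [set k]) `&` \bigcap_(j < k) E j).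
  apply: measurableI; last exact: bigcap_measurableType.
  by apply: measurableI => //; rewrite -[X in measurable X]setTI; exact: mK.
rewrite (_ : D `&` _ =
    \bigcup_k ((D `&` K @^-1` [set k]) `&` \bigcap_(j < k) E j)).
  rewrite measure_bigcup//; first by apply: eq_eseriesl => k; rewrite in_setT.
  by move=> i j _ _ [w [[[_ /= Ki] _] [[_ /= Kj] _]]]; rewrite -Ki.
apply/seteqP; split => [w [Dw Ew]|w [k _ [[Dw /= Kwk] Ew]]].
  by exists (K w) => //; split => // j /=; exact: Ew.
by split => // j; rewrite /= Kwk; exact: Ew.
Qed.

(** Membership in the cluster of the subtree rooted at [v], as a recursion from
    the top of the tree; [in_cluster] adds labels at the bottom, which is the
    wrong end for cutting the tree at its root. *)
Fixpoint descends (nc : seq nat -> nat) (v u : seq nat) : bool :=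
  if u is j :: u' then (j < nc v)%N && descends nc (rcons v j) u' else true.

Lemma descends_rcons nc v u i :
  descends nc v (rcons u i) = descends nc v u && (i < nc (v ++ u))%N.
Proof.
elim: u v => [|j u IH] v /=; first by rewrite cats0 andbT.
by rewrite IH andbA cat_rcons.
Qed.

Lemma in_clusterP nc u : in_cluster nc u <-> descends nc [::] u.
Proof.
split; first by elim=> // {}u i _ + iu; rewrite descends_rcons => ->.
elim/last_ind: u => [_|u i IH]; first exact: in_cluster_root.
by rewrite descends_rcons => /andP[/IH ? ?]; exact: in_cluster_child.
Qed.

Section branching.
Context d d' (A : measurableType d) (T : measurableType d') (R : realType)
  (F : probability A R) (h : R * A -> R) (P : probability T R)
  (mark : seq nat -> T -> A) (nchild : seq nat -> T -> nat).
Hypothesis cluster : hawkes_cluster F h P mark nchild.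

Definition label_sigma (u : seq nat) := sigma_of (fun w => (mark u w, nchild u w)).

Let mMN u : measurable_fun [set: T] (fun w => (mark u w, nchild u w)).
Proof.
apply/measurable_fun_pairP; split.
  exact: (measurable_mark cluster).
exact: (measurable_nchild cluster).
Qed.

Let sigma_mark u B : measurable B -> label_sigma u (mark u @^-1` B).
Proof.
move=> mB; rewrite (_ : _ @^-1` _ =
  (fun w => (mark u w, nchild u w)) @^-1` (B `*` setT)).
  by apply: preimage_sigma_of; exact: measurableX.
by apply/seteqP; split => [w|w []].
Qed.

Let sigma_nchild u N : label_sigma u (nchild u @^-1` N).
Proof.
rewrite (_ : _ @^-1` _ =
  (fun w => (mark u w, nchild u w)) @^-1` (setT `*` N)).
  by apply: preimage_sigma_of; exact: measurableX.
by apply/seteqP; split => [w|w []].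
Qed.

Definition labels_below (v : seq nat) : set (seq nat) := [set u | prefix v u].

Lemma measurable_sigma_join S : sigma_join label_sigma S `<=` measurable.
Proof.
by apply: sigma_join_measurable => u; exact: sigma_of_measurable.
Qed.

Lemma labels_independent S S' C C' : S `&` S' = set0 ->
  sigma_join label_sigma S C -> sigma_join label_sigma S' C' -> P (C `&` C') = (P C * P C')%E.
Proof.
apply: sigma_join_independent.
- by move=> u; exact: sigma_ofI.
- by move=> u; exact: sigma_ofT.
- by move=> u; exact: sigma_of_measurable.
- exact: (individuals_independent cluster).
Qed.

(** The number of children only selects how many of the events [E j] are
    required, and given that number these depend on the subtrees of distinct
    children, hence on disjoint sets of labels, none of which is [v]. *)
Lemma branching_probability (v : seq nat) (B : set A) (E : nat -> set T) :
    measurable B -> (forall j, sigma_join label_sigma (labels_below (rcons v j)) (E j)) ->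
  P (mark v @^-1` B `&` [set w | forall j, (j < nchild v w)%N -> E j w]) =
  (\sum_(0 <= k <oo) (P (mark v @^-1` B `&` nchild v @^-1` [set k])
     * \prod_(j < k) P (E j)))%E.
Proof.
move=> mB GE.
rewrite probability_random_bigcap//; last first.
- by move=> j; exact: measurable_sigma_join (GE j).
- exact: (measurable_nchild cluster).
- rewrite -[X in measurable X]setTI.
  exact: (measurable_mark cluster).
pose below k := [set u | exists2 j, (j < k)%N & prefix (rcons v j) u].
have belowE k : sigma_join label_sigma (below k) (\bigcap_(j < k) E j) /\
    P (\bigcap_(j < k) E j) = (\prod_(j < k) P (E j))%E.
  elim: k => [|k [IHs IHP]].
    by rewrite big_ord0 bigcap_mkord big_ord0; split;
       [exact: sigma_joinT|exact: probability_setT].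
  rewrite bigcap_mkord big_ord_recr/= -bigcap_mkord; split.
    apply: (@measurableI _ (g_sigma_algebraType (\bigcup_(i in below k.+1) label_sigma i))).
      apply: sigma_join_subset IHs => u [j jk ju]; exists j => //.
      exact: ltnW.
    by apply: sigma_join_subset (GE k) => u ku; exists k.
  rewrite big_ord_recr/= -IHP; apply: labels_independent IHs (GE k).
  apply/seteqP; split => // u [[j jk]] /prefixP[s ->] /= /prefixP[s'].
  rewrite !cat_rcons => /eqP; rewrite eqseq_cat// eqxx /= => /eqP[jk' _].
  by rewrite jk' ltnn in jk.
apply: eq_eseriesr => k _; have [sk <-] := belowE k.
apply: (@labels_independent [set v] (below k)) => //.
  apply/seteqP; split => // u [-> [j _ /prefixP[s]]].
  by move=> /(congr1 size)/eqP; rewrite size_cat size_rcons addSnnS -[X in X == _]addn0 eqn_add2l.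
apply: (sub_sigma_join (i := v)) => //; apply: sigma_ofI.
  exact: sigma_mark.
exact: sigma_nchild.
Qed.

Context (f : A -> R).
Hypothesis f_meas : measurable_fun [set: A] f.

(** Truncation at generation [n] makes the common law of the subtrees accessible
    to induction; the full subtree is its decreasing limit. *)
Definition below_to n v x : set T := [set w | forall u, (size u <= n)%N ->
  descends (nchild^~ w) v u -> f (mark (v ++ u) w) <= x].

Definition below_all v x : set T := [set w | forall u,
  descends (nchild^~ w) v u -> f (mark (v ++ u) w) <= x].

Definition marks_below x : set A := [set a | f a <= x].

Lemma measurable_marks_below x : measurable (marks_below x).
Proof.
rewrite -[X in measurable X]setTI (_ : marks_below x = f @^-1` `]-oo, x]).
  exact: f_meas.
by apply/seteqP; split => a /=; rewrite in_itv.
Qed.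

Lemma below_to0 v x : below_to 0 v x = mark v @^-1` marks_below x.
Proof.
apply/seteqP; split => w /= H.
  by have := H [::]; rewrite cats0; exact.
by move=> u; rewrite leqn0 size_eq0 => /eqP -> _; rewrite cats0.
Qed.

Lemma below_toS n v x : below_to n.+1 v x = mark v @^-1` marks_below x `&`
  [set w | forall j, (j < nchild v w)%N -> below_to n (rcons v j) x w].
Proof.
apply/seteqP; split => w /=.
  move=> H; split => [|j jv u un uv]; first by have := H [::]; rewrite cats0; exact.
  by rewrite cat_rcons; apply: H => //=; rewrite jv.
move=> [H0 H] [_ _|j u]; first by rewrite cats0.
by rewrite ltnS -cat_rcons => un /= /andP[jv]; exact: H.
Qed.

Lemma below_all_rec v x : below_all v x = mark v @^-1` marks_below x `&`
  [set w | forall j, (j < nchild v w)%N -> below_all (rcons v j) x w].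
Proof.
apply/seteqP; split => w /=.
  move=> H; split => [|j jv u uv]; first by have := H [::]; rewrite cats0; exact.
  by rewrite cat_rcons; apply: H => //=; rewrite jv.
move=> [H0 H] [_|j u]; first by rewrite cats0.
by rewrite -cat_rcons => /= /andP[jv]; exact: H.
Qed.

Lemma below_all_bigcap v x : below_all v x = \bigcap_n below_to n v x.
Proof.
apply/seteqP; split => [w H n _ u _|w H u]; first exact: H.
exact: (H (size u)).
Qed.

Let sigma_join_descends v u : sigma_join label_sigma (labels_below v)
  [set w | descends (nchild^~ w) v u].
Proof.
elim: u v => [|j u IH] v.
  by rewrite [X in sigma_join _ _ X](_ : _ = setT);
    [exact: sigma_joinT|apply/seteqP; split].
rewrite [X in sigma_join _ _ X](_ : _ = nchild v @^-1` [set k | (j < k)%N] `&`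
  [set w | descends (nchild^~ w) (rcons v j) u]); last first.
  by apply/seteqP; split => w /= => [/andP[]|[->]].
apply: (@measurableI _ (g_sigma_algebraType _)).
  by apply: (sub_sigma_join (i := v)); [exact: prefix_refl|exact: sigma_nchild].
apply: sigma_join_subset (IH (rcons v j)) => u' /prefixP[s ->].
by rewrite /labels_below /= cat_rcons prefix_prefix.
Qed.

Lemma sigma_join_below_to n v x :
  sigma_join label_sigma (labels_below v) (below_to n v x).
Proof.
rewrite (_ : below_to n v x = \bigcap_u (if (size u <= n)%N then
    ~` [set w | descends (nchild^~ w) v u] `|` mark (v ++ u) @^-1` marks_below x
    else setT)); last first.
  apply/seteqP; split => w H u.
    move=> _; case: ifPn => // un /=.
    have [/(H _ un)|] := boolP (descends (nchild^~ w) v u); first by right.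
    by left.
  by move=> un uv; have := H u I; rewrite un => -[].
apply: sigma_join_bigcap => [|u]; first exact: countableP.
case: ifPn => _; last exact: sigma_joinT.
apply: sigma_joinU; first exact: sigma_joinC.
apply: (sub_sigma_join (i := v ++ u)); first exact: prefix_prefix.
exact/sigma_mark/measurable_marks_below.
Qed.

Lemma sigma_join_below_all v x :
  sigma_join label_sigma (labels_below v) (below_all v x).
Proof.
rewrite below_all_bigcap; apply: sigma_join_bigcap => // n.
exact: sigma_join_below_to.
Qed.

Lemma measurable_below_to n v x : measurable (below_to n v x).
Proof. by apply: measurable_sigma_join; exact: sigma_join_below_to. Qed.

Lemma measurable_below_all v x : measurable (below_all v x).
Proof. by apply: measurable_sigma_join; exact: sigma_join_below_all. Qed.

(** One generation of [branching_probability] expresses the probability for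
    [n.+1] through the joint law of a mark and a number of children, the same
    at all labels, and the probabilities for [n]. *)
Lemma probability_below_to n v x : P (below_to n v x) = P (below_to n [::] x).
Proof.
elim: n v => [|n IH] v.
  by rewrite !below_to0 !(mark_law cluster)//; exact: measurable_marks_below.
rewrite !below_toS !branching_probability//;
  try exact: measurable_marks_below; try by move=> j; exact: sigma_join_below_to.
apply: eq_eseriesr => k _.
rewrite !(nchild_law cluster)//; try exact: measurable_marks_below.
by congr (_ * _)%E; apply: eq_bigr => j _; rewrite IH [RHS]IH.
Qed.

Lemma probability_below_all v x : P (below_all v x) = P (below_all [::] x).
Proof.
have cvgP v' : P (below_to n v' x) @[n --> \oo] --> P (below_all v' x).
  rewrite below_all_bigcap; apply: nonincreasing_cvg_mu.
  - by rewrite ltey_eq fin_num_measure//; exact: measurable_below_to.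
  - by move=> n; exact: measurable_below_to.
  - by rewrite -below_all_bigcap; exact: measurable_below_all.
  - move=> m n mn; apply/subsetPset => w H u um; apply: H.
    exact: leq_trans um mn.
have := cvgP v; under eq_fun do rewrite probability_below_to.
by move=> /cvg_unique; apply => //; exact: cvgP.
Qed.

Lemma below_all_fixed_point x : P (below_all [::] x) =
  (\sum_(0 <= k <oo)
     (P ([set w | (f (mark [::] w) <= x)%R] `&` nchild [::] @^-1` [set k])
      * (fine (P (below_all [::] x)) ^+ k)%:E))%E.
Proof.
rewrite [in LHS]below_all_rec branching_probability//; last first.
- by move=> j; exact: sigma_join_below_all.
- exact: measurable_marks_below.
apply: eq_eseriesr => k _; congr (_ * _)%E.
rewrite (eq_bigr (fun=> (fine (P (below_all [::] x)))%:E)).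
  by rewrite prodEFin prodr_const card_ord.
move=> j _; rewrite probability_below_all fineK// fin_num_measure//.
exact: measurable_below_all.
Qed.

Lemma cluster_max_le w x :
  (cluster_max f mark nchild w <= x%:E)%E <-> below_all [::] x w.
Proof.
split => [H u uw|H].
  rewrite -lee_fin; apply: le_trans H; apply: ereal_sup_ubound.
  by exists u => //; apply/in_clusterP.
apply: ge_ereal_sup => _ [u /in_clusterP uw <-].
by rewrite lee_fin; exact: H.
Qed.

End branching.
(** * Laws on the extended line and the distributional equation *)

Section laws_on_ereal.
Context (R : realType).

Lemma preimage_gt_setC (T : Type) (Y : T -> \bar R) (x : R) :
  Y @^-1` `]x%:E, +oo[ = ~` [set w | (Y w <= x%:E)%E].
Proof.
by apply/seteqP; split => w /=; rewrite in_itv/= andbT ltNge => /negP.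
Qed.

Lemma measurable_fun_ereal_le d (T : measurableType d) (Y : T -> \bar R) :
  (forall x : R, measurable [set w | (Y w <= x%:E)%E]) ->
  measurable_fun [set: T] Y.
Proof.
move=> mY; apply: (measurability _ (ErealGenOInfty.measurableE R)).
move=> _ [_ [x ->] <-]; rewrite setTI.
rewrite preimage_gt_setC.
exact: measurableC.
Qed.

Lemma same_law_ereal_le d d' (T : measurableType d) (T' : measurableType d')
    (P : probability T R) (Q : probability T' R)
    (Y : T -> \bar R) (Z : T' -> \bar R) :
    (forall x : R, measurable [set w | (Y w <= x%:E)%E]) ->
    (forall x : R, measurable [set w | (Z w <= x%:E)%E]) ->
    (forall x : R, P [set w | (Y w <= x%:E)%E] = Q [set w | (Z w <= x%:E)%E]) ->
  same_law P Y Q Z.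
Proof.
move=> mY mZ PQ B mB.
have mPY C : measurable C -> measurable (Y @^-1` C).
  by move=> mC; rewrite -[X in measurable X]setTI; exact: measurable_fun_ereal_le.
have mQZ C : measurable C -> measurable (Z @^-1` C).
  by move=> mC; rewrite -[X in measurable X]setTI; exact: measurable_fun_ereal_le.
have mE : @measurable _ (\bar R) = <<s @ErealGenOInfty.G R >>.
  exact: ErealGenOInfty.measurableE.
suff : [set B | P (Y @^-1` B) = Q (Z @^-1` B)] B by [].
apply: (dynkin_induction (G := @ErealGenOInfty.G R)).
- exact: mE.
- move=> _ _ [x ->] [y ->]; exists (Num.max x y).
  by apply/seteqP; split => z /=; rewrite !in_itv/= !andbT EFin_max gt_max => // /andP.
- by rewrite /= !preimage_setT !probability_setT.
- move=> _ [x ->] /=.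
  by rewrite !preimage_gt_setC !probability_setC// PQ.
- move=> S mS /= PQS.
  rewrite 2!preimage_setC (probability_setC P (mPY _ mS)).
  by rewrite (probability_setC Q (mQZ _ mS)) PQS.
- move=> E mE0 tE PQE /=; rewrite !preimage_bigcup !measure_semi_bigcup.
  + by apply: eq_eseriesr => k _; exact: PQE.
  + by move=> i; apply: mQZ; exact: mE0.
  + by move=> i j _ _ [w [Ei Ej]]; apply: tE => //; exists (Z w); split.
  + by apply: bigcupT_measurable => i; apply: mQZ; exact: mE0.
  + by move=> i; apply: mPY; exact: mE0.
  + by move=> i j _ _ [w [Ei Ej]]; apply: tE => //; exists (Y w); split.
  + by apply: bigcupT_measurable => i; apply: mPY; exact: mE0.
- by rewrite -mE.
Qed.

End laws_on_ereal.

Section max_equation.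
Context d (T : measurableType d) (R : realType) (Q : probability T R)
  (XL : T -> R * nat) (H : nat -> T -> \bar R).
Hypotheses (mXL : measurable_fun [set: T] XL)
  (mH : forall j, measurable_fun [set: T] (H j)).
Hypothesis indep : mutually_independent Q (fun i : option nat =>
  if i is Some j then sigma_of (H j) else sigma_of XL).

Let Z w := maxe (XL w).1%:E (\big[maxe/-oo%E]_(j < (XL w).2) H j w).

Let ZE x : [set w | (Z w <= x%:E)%E] = XL @^-1` (`]-oo, x] `*` setT) `&`
  [set w | forall j, (j < (XL w).2)%N -> (H j w <= x%:E)%E].
Proof.
apply/seteqP; split => w /=; rewrite /Z ge_max lee_fin in_itv/=.
  by move=> /andP[-> /bigmax_leP[_ Hx]]; split => // j jL; exact: (Hx (Ordinal jL)).
by move=> [[-> _] Hx]; apply/bigmax_leP; rewrite leNye; split => // j _; exact: Hx.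
Qed.

Let mXLx x : measurable (XL @^-1` (`]-oo, x] `*` setT)).
Proof. by rewrite -[X in measurable X]setTI; apply: mXL => //; exact: measurableX. Qed.

Let mHx j x : measurable [set w | (H j w <= x%:E)%E].
Proof. by rewrite -[X in measurable X]setTI; exact: emeasurable_fun_infty_c. Qed.

Lemma measurable_max_le x : measurable [set w | (Z w <= x%:E)%E].
Proof.
rewrite ZE; apply: measurableI => //.
have -> : [set w | forall j, (j < (XL w).2)%N -> (H j w <= x%:E)%E] =
   \bigcap_j (XL @^-1` (setT `*` [set k | (k <= j)%N]) `|` [set w | (H j w <= x%:E)%E]).
  apply/seteqP; split => w /= Hx j.
    by move=> _; have [/Hx|] := ltnP j (XL w).2; [right|left].
  by move=> jL; have [[_ /=]|//] := Hx j I; rewrite leqNgt jL.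
apply: bigcapT_measurable => j; apply: measurableU => //.
by rewrite -[X in measurable X]setTI; apply: mXL => //; exact: measurableX.
Qed.

(** The counterpart, for arbitrary independent copies, of the formula satisfied
    by the cluster maximum in [cluster_max_cdf]. *)
Lemma probability_max_le x : Q [set w | (Z w <= x%:E)%E] =
  (\sum_(0 <= k <oo) (Q (XL @^-1` (`]-oo, x] `*` [set k]))
     * \prod_(j < k) Q [set w | (H j w <= x%:E)%E]))%E.
Proof.
have mL : measurable_fun [set: T] (fun w => (XL w).2).
  exact: (measurableT_comp measurable_snd mXL).
rewrite ZE (probability_random_bigcap Q (mXLx x) mL (mHx^~ x)).
apply: eq_eseriesr => k _.
pose B (i : option nat) := if i is Some j then [set w | (H j w <= x%:E)%E]
  else XL @^-1` (`]-oo, x] `*` [set k]).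
have -> : XL @^-1` (`]-oo, x] `*` setT) `&`
    (fun x0 : T => (XL x0).2) @^-1` [set k] `&`
    \bigcap_(j < k) [set w | (H j w <= x%:E)%E] =
    \bigcap_(i in [set` None :: [seq Some j | j <- index_iota 0 k]]) B i.
  apply/seteqP; split => [w [[/= [XLx _] XLk] Hx] [j|]//= |w Bw].
    by rewrite inE/= => /mapP[j']; rewrite mem_index_iota => j'k [->]; exact: Hx.
  have [/= XLx XLk] := Bw None (mem_head _ _).
  split => // j /= jk; apply: (Bw (Some j)) => /=.
  by rewrite inE/=; apply/mapP; exists j => //; rewrite mem_index_iota.
rewrite indep.
- by rewrite big_cons big_map big_mkord.
- rewrite /= map_inj_uniq ?iota_uniq ?andbT; last by move=> ? ? [].
  by apply/mapP => -[].
- move=> [j|] _ /=.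
    exists [set` `]-oo, x%:E]]; first exact: emeasurable_itv.
    by rewrite setTI; apply/seteqP; split => w /=; rewrite in_itv.
  by apply: preimage_sigma_of; exact: measurableX.
Qed.

End max_equation.

Section cluster_max_law.
Context d d' (A : measurableType d) (T : measurableType d') (R : realType)
  (F : probability A R) (h : R * A -> R) (P : probability T R)
  (mark : seq nat -> T -> A) (nchild : seq nat -> T -> nat)
  (cluster : hawkes_cluster F h P mark nchild)
  (f : A -> R) (f_meas : measurable_fun [set: A] f).

Let HH := cluster_max f mark nchild.

Lemma cluster_max_leE x :
  [set w | (HH w <= x%:E)%E] = below_all mark nchild f [::] x.
Proof. by rewrite /HH; apply/seteqP; split => w /= /cluster_max_le. Qed.

Lemma measurable_cluster_max_le x : measurable [set w | (HH w <= x%:E)%E].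
Proof.
by rewrite cluster_max_leE; exact: (measurable_below_all cluster f_meas).
Qed.

Lemma measurable_cluster_max : measurable_fun [set: T] HH.
Proof. exact/measurable_fun_ereal_le/measurable_cluster_max_le. Qed.

Lemma cluster_max_cdf x : P [set w | (HH w <= x%:E)%E] =
  (\sum_(0 <= k <oo)
     (P ([set w | (f (mark [::] w) <= x)%R] `&` nchild [::] @^-1` [set k])
      * (fine (P [set w | (HH w <= x%:E)%E]) ^+ k)%:E))%E.
Proof. by rewrite cluster_max_leE -(below_all_fixed_point cluster f_meas). Qed.

Lemma cluster_max_fixed_point :
  max_fixed_point P (fun w => f (mark [::] w)) (nchild [::]) HH.
Proof.
move=> d'' T' Q XL H mXL mH lawXL lawH indep.
apply: same_law_ereal_le => x.
- exact: measurable_cluster_max_le.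
- exact: measurable_max_le.
rewrite probability_max_le// cluster_max_cdf; apply: eq_eseriesr => k _.
congr (_ * _)%E.
  rewrite -lawXL; last exact: measurableX.
  by congr (P _); apply/seteqP; split => w /=; rewrite in_itv.
rewrite (eq_bigr (fun=> (fine (P [set w | (HH w <= x%:E)%E]))%:E)).
  by rewrite prodEFin prodr_const card_ord.
move=> j _.
have HE U (Y : U -> \bar R) :
    [set w | (Y w <= x%:E)%E] = Y @^-1` [set` `]-oo, x%:E]].
  by apply/seteqP; split => w /=; rewrite in_itv.
rewrite fineK; last exact: fin_num_measure (measurable_cluster_max_le x).
rewrite (HE _ HH) (HE _ (H j)); apply: esym; apply: (lawH j).
exact: emeasurable_itv.
Qed.

End cluster_max_law.

(** * The mean number of children *)

Lemma integral_nat_valued d (T : measurableType d) (R : realType)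
    (mu : {measure set T -> \bar R}) (D : set T) (K : T -> nat) (g : nat -> R) :
    measurable D -> measurable_fun [set: T] K -> (forall k, 0 <= g k) ->
  (\int[mu]_(w in D) (g (K w))%:E =
   \sum_(0 <= k <oo) (mu (D `&` K @^-1` [set k]) * (g k)%:E))%E.
Proof.
move=> mD mK g0.
have mDk k : measurable (D `&` K @^-1` [set k]).
  by apply: measurableI => //; rewrite -[X in measurable X]setTI; exact: mK.
have DE : D = \bigcup_k (D `&` K @^-1` [set k]).
  by apply/seteqP; split => [w Dw|w [k _ []//]]; exists (K w).
rewrite [in LHS]DE ge0_integral_bigcup//.
- apply: eq_eseriesr => k _; rewrite muleC -integral_cst//.
  by apply: eq_integral => w /set_mem[_ /= ->].
- rewrite -DE; apply: measurable_funTS.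
  apply/measurable_EFinP; apply: (measurableT_comp (f := g)) mK.
  by move=> _ Y _; rewrite setTI.
- by move=> w _; rewrite lee_fin.
- by move=> i j _ _ [w [[_ /= <-] [_ /= <-]]].
Qed.

Section poisson_mean.
Context (R : realType).

Lemma poisson_prob_set1 (r : R) k : poisson_prob r 0%N [set k] =
  (if 0 < r then poisson_pmf r k else (k == 0%N)%:R)%:E.
Proof.
rewrite /poisson_prob; case: ifPn => _.
  by rewrite esum_set1// lee_fin poisson_pmf_ge0.
rewrite diracE; have [->|k0] := eqVneq k 0%N; first by rewrite mem_set.
by rewrite memNset// => /= k0'; rewrite -k0' eqxx in k0.
Qed.

Lemma measurable_poisson_set1 k :
  measurable_fun [set: R] (fun r : R => poisson_prob r 0%N [set k]).
Proof.
under eq_fun do rewrite poisson_prob_set1.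
apply/measurable_EFinP; apply: measurable_fun_ifT => //.
  exact: measurable_fun_ltr.
exact: measurable_poisson_pmf.
Qed.

(** The weights satisfy (k + 1) p_(k+1) = r p_k, so that the mean is r times the
    total mass; this form covers the degenerate rate r = 0 as well. *)
Lemma poisson_mean (r : R) : 0 <= r ->
  (\sum_(0 <= k <oo) (poisson_prob r 0%N [set k] * k%:R%:E) = r%:E)%E.
Proof.
move=> r0; have p0 k : (0 <= poisson_prob r 0%N [set k])%E by exact: measure_ge0.
rewrite nneseries_recl//; last by move=> k _; rewrite mule_ge0// lee_fin.
rewrite mule0 add0e -(nneseries_addn 1%N); last first.
  by move=> k; rewrite mule_ge0// lee_fin.
rewrite (eq_eseriesr (g := fun k => (r%:E * poisson_prob r 0%N [set k])%E)).
  have := @measure_semi_bigcup _ _ _ (poisson_prob r 0%N) (fun k => [set k]).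
  rewrite nneseriesZl// => <-//.
  - rewrite (_ : \bigcup_n [set n] = setT); last first.
      by apply/seteqP; split => // k _; exists k.
    rewrite -[RHS]mule1; congr (_ * _)%E.
    exact: (@probability_setT _ _ _ (poisson_prob r 0%N)).
  - by move=> i j _ _ [k [/= -> ->]].
move=> k _; rewrite addn1 !poisson_prob_set1 -!EFinM; congr EFin.
case: ifPn => [rgt0|]; last first.
  by rewrite mul0r -leNgt => rle0; rewrite (@le_anti _ _ r 0) ?mul0r// rle0.
rewrite /poisson_pmf rgt0 factS natrM exprS invfM.
have : (k.+1%:R : R) != 0 by rewrite pnatr_eq0.
have : (k`!%:R : R) != 0 by rewrite pnatr_eq0 -lt0n fact_gt0.
by move: (k.+1%:R : R) (k`!%:R : R) => c u u0 c0; field; rewrite u0.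
Qed.

End poisson_mean.

(** [h] is measurable on positive times only, so it is extended by 0 before
    Tonelli's theorem is applied. *)
Lemma measurable_kappa d (A : measurableType d) (R : realType) (h : R * A -> R) :
    measurable_fun ((`]0, +oo[ : set R) `*` [set: A]) h ->
    (forall t a, 0 < t -> 0 <= h (t, a)) ->
  measurable_fun [set: A] (kappa h).
Proof.
move=> mh h0; pose D := (`]0, +oo[ : set R) `*` [set: A].
have mD : measurable D by exact: measurableX.
pose g : R * A -> \bar R := (EFin \o h) \_ D.
have mg : measurable_fun setT g.
  by apply/(measurable_restrictT _ mD); exact/measurable_EFinP.
have g0 z : (0 <= g z)%E.
  rewrite /g patchE; case: ifPn => // /set_mem[/=]; rewrite in_itv/= andbT.
  by case: z => t a /= t0 _; rewrite lee_fin h0.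
rewrite (_ : kappa h = fubini_G lebesgue_measure g).
  exact: measurable_fun_fubini_tonelli_G.
apply/funext => a; rewrite /kappa /fubini_G [LHS]integral_mkcond.
apply: eq_integral => t _; rewrite /g !patchE.
have -> : ((t, a) \in D) = (t \in [set` `]0%R, +oo[]).
  by apply/idP/idP => /set_mem; [case=> /= t0 _|move=> /= t0]; apply/mem_set.
by [].
Qed.

Lemma kappa_ge0 d (A : measurableType d) (R : realType) (h : R * A -> R) a :
  (forall t a, 0 < t -> 0 <= h (t, a)) -> (0 <= kappa h a)%E.
Proof.
move=> h0; apply: integral_ge0 => t /=; rewrite in_itv/= andbT => t0.
by rewrite lee_fin h0.
Qed.

Section offspring_mean.
Context d d' (A : measurableType d) (T : measurableType d') (R : realType)
  (F : probability A R) (h : R * A -> R) (P : probability T R)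
  (mark : seq nat -> T -> A) (nchild : seq nat -> T -> nat)
  (cluster : hawkes_cluster F h P mark nchild)
  (h_meas : measurable_fun ((`]0, +oo[ : set R) `*` [set: A]) h)
  (h_ge0 : forall t a, 0 < t -> 0 <= h (t, a)).

Lemma integral_kappa_mark u :
  (\int[P]_w kappa h (mark u w) = \int[F]_a kappa h a)%E.
Proof.
have mm : measurable_fun setT (mark u) := measurable_mark cluster u.
have := @ge0_integral_pushforward _ _ _ _ R _ mm P setT (kappa h) measurableT.
rewrite preimage_setT => <-.
- apply: eq_measure_integral => B mB _; exact: (mark_law cluster u mB).
- exact: measurable_kappa.
- by move=> a _; exact: kappa_ge0.
Qed.

(** Almost every rate is finite because its mean is, so replacing infinite rates
    by 0 does not change the mean. *)
Lemma expected_nchild u : (\int[F]_a kappa h a < +oo)%E ->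
  (\int[P]_w ((nchild u w)%:R : R)%:E = \int[F]_a kappa h a)%E.
Proof.
move=> kfin; have mk := measurable_kappa h_meas h_ge0.
have mfk : measurable_fun setT (fun a => fine (kappa h a)).
  exact: measurableT_comp mk.
have mp k : measurable_fun setT
    (fun a => poisson_prob (fine (kappa h a)) 0%N [set k]).
  exact: (measurableT_comp (@measurable_poisson_set1 R k) mfk).
rewrite (integral_nat_valued P (g := fun k => k%:R))//; last first.
  exact: (measurable_nchild cluster).
transitivity (\sum_(0 <= k <oo) \int[F]_a
    (poisson_prob (fine (kappa h a)) 0%N [set k] * (k%:R : R)%:E))%E.
  apply: eq_eseriesr => k _.
  transitivity (P (mark u @^-1` setT `&` nchild u @^-1` [set k])
      * (k%:R : R)%:E)%E; first by rewrite preimage_setT.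
  rewrite (nchild_law cluster)//.
  by rewrite ge0_integralZr// lee_fin.
rewrite -integral_nneseries//; last 2 first.
- by move=> k; exact: emeasurable_funM.
- by move=> k a _; rewrite mule_ge0// lee_fin.
apply: ae_eq_integral => //.
- apply: ge0_emeasurable_sum => // k; first by move=> a _ _; rewrite mule_ge0// lee_fin.
  by move=> _; exact: emeasurable_funM.
have : F.-integrable setT (kappa h).
  apply/integrableP; split => //.
  by under eq_integral do rewrite gee0_abs ?kappa_ge0//.
move=> /(integrable_ae measurableT); apply: filterS => a /(_ I) ka _.
by rewrite poisson_mean ?fineK// fine_ge0// kappa_ge0.
Qed.

End offspring_mean.
(** * The tail of the solution of the equation *)

Section tail_facts.
Context d (T : measurableType d) (R : realType) (P : probability T R).
Implicit Types Z : T -> \bar R.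

Lemma tail_ge0 Z x : 0 <= tail P Z x.
Proof. by rewrite /tail fine_ge0. Qed.

Lemma measurable_gt Z x : measurable_fun [set: T] Z ->
  measurable [set w | (x%:E < Z w)%E].
Proof.
by move=> mZ; rewrite -[X in measurable X]setTI; exact: emeasurable_fun_o_infty.
Qed.

Lemma tailE Z x : measurable_fun [set: T] Z ->
  (tail P Z x)%:E = P [set w | (x%:E < Z w)%E].
Proof.
by move=> mZ; rewrite /tail fineK// fin_num_measure//; exact: measurable_gt.
Qed.

Lemma tail_nonincreasing Z : measurable_fun [set: T] Z ->
  {homo tail P Z : x y /~ x <= y}.
Proof.
move=> mZ x y yx; rewrite -lee_fin !tailE//; apply: le_measure.
- by rewrite inE; exact: measurable_gt.
- by rewrite inE; exact: measurable_gt.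
- by move=> w /=; apply: le_lt_trans; rewrite lee_fin.
Qed.

Lemma tail_setC Z x : measurable_fun [set: T] Z ->
  tail P Z x = 1 - fine (P [set w | (Z w <= x%:E)%E]).
Proof.
move=> mZ; have mle : measurable [set w | (Z w <= x%:E)%E].
  by rewrite -[X in measurable X]setTI; exact: emeasurable_fun_infty_c.
rewrite /tail (_ : [set w | (x%:E < Z w)%E] = ~` [set w | (Z w <= x%:E)%E]).
  by rewrite probability_setC// fineB//; exact: fin_num_measure.
by apply/seteqP; split => w /=; rewrite ltNge => /negP.
Qed.

Lemma tail_cvg0 (X : T -> R) : measurable_fun [set: T] X ->
  tail P (EFin \o X) x @[x --> +oo] --> (0 : R).
Proof.
move=> mX; have mX' : measurable_fun setT (EFin \o X) by exact/measurable_EFinP.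
have cvg_nat : tail P (EFin \o X) n%:R @[n --> \oo] --> (0 : R).
  apply: fine_cvg.
  rewrite (_ : 0%:E = P (\bigcap_n [set w | (n%:R%:E < (X w)%:E)%E])).
    apply: nonincreasing_cvg_mu.
    - by rewrite ltey_eq fin_num_measure//; exact: measurable_gt.
    - by move=> n; exact: measurable_gt.
    - by apply: bigcapT_measurable => n; exact: measurable_gt.
    - move=> m n mn; apply/subsetPset => w /=; apply: le_lt_trans.
      by rewrite lee_fin ler_nat.
  rewrite (_ : \bigcap_n _ = set0) ?measure0//.
  apply/seteqP; split => // w /= Xw.
  have [n _ /(_ n (leqnn n))] := nbhs_infty_ger (X w).
  by have := Xw n I; rewrite /= lte_fin leNgt => ->.
apply/cvgrPdist_lt => e e0.
move/cvgrPdist_lt : cvg_nat => /(_ _ e0)[N _ /(_ N (leqnn N))] /=.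
rewrite !sub0r !normrN ger0_norm ?tail_ge0// => pN.
near=> x; rewrite sub0r normrN ger0_norm ?tail_ge0//.
apply: le_lt_trans pN. apply: (tail_nonincreasing mX').
by near: x; exact: nbhs_pinfty_ge.
Unshelve. all: by end_near. Qed.

End tail_facts.

(** Everything about the cluster maximum [H] that matters for its tail is the
    equation [cdfH] for its distribution function and the subcriticality
    [m < 1]. *)
Section max_recursion.
Context d (T : measurableType d) (R : realType) (P : probability T R)
  (X : T -> R) (K : T -> nat) (H : T -> \bar R) (m : R).
Hypotheses (mX : measurable_fun [set: T] X) (mK : measurable_fun [set: T] K)
  (mH : measurable_fun [set: T] H).
Hypothesis cdfH : forall x, P [set w | (H w <= x%:E)%E] =
  (\sum_(0 <= k <oo) (P ([set w | (X w <= x)%R] `&` K @^-1` [set k])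
     * (fine (P [set w | (H w <= x%:E)%E]) ^+ k)%:E))%E.
Hypotheses (meanK : (\int[P]_w ((K w)%:R : R)%:E = m%:E)%E) (m_lt1 : m < 1).

Let q x := fine (P [set w | (H w <= x%:E)%E]).
Let G x := tail P H x.
Let p x := tail P (EFin \o X) x.

Let mle x : measurable [set w | (H w <= x%:E)%E].
Proof. by rewrite -[X in measurable X]setTI; exact: emeasurable_fun_infty_c. Qed.

Let mXle x : measurable [set w | X w <= x].
Proof.
rewrite -[X in measurable X]setTI (_ : [set w | X w <= x] = X @^-1` `]-oo, x]).
  exact: mX.
by apply/seteqP; split => a /=; rewrite in_itv.
Qed.

Let q_ge0 x : 0 <= q x. Proof. by rewrite fine_ge0. Qed.

Let q_le1 x : q x <= 1.
Proof.
by rewrite -lee_fin /q fineK ?fin_num_measure//; exact: probability_le1.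
Qed.

Let GE x : G x = 1 - q x. Proof. exact: tail_setC. Qed.

Let q_mono x y : x <= y -> q x <= q y.
Proof.
by move=> xy; rewrite -lerN2 -(lerD2l 1) -!GE; exact: tail_nonincreasing.
Qed.

Definition geometric_sum (a : R) k : R := \sum_(i < k) a ^+ i.

Let geo_ge0 a k : 0 <= a -> 0 <= geometric_sum a k.
Proof. by move=> a0; apply: sumr_ge0 => i _; exact: exprn_ge0. Qed.

Let geo_mono a b k : 0 <= a -> a <= b -> geometric_sum a k <= geometric_sum b k.
Proof.
by move=> a0 ab; apply: ler_sum => i _; rewrite lerXn2r// nnegrE (le_trans a0).
Qed.

Let geo1 k : geometric_sum 1 k = k%:R.
Proof.
rewrite /geometric_sum (eq_bigr (fun=> 1)) => [|i _]; last by rewrite expr1n.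
by rewrite sumr_const card_ord.
Qed.

Let measurable_of_K (g : nat -> R) :
  measurable_fun [set: T] (fun w => (g (K w))%:E).
Proof.
apply/measurable_EFinP; apply: (measurableT_comp (f := g)) mK.
by move=> _ Y _; rewrite setTI.
Qed.

Let eM x := (\int[P]_(w in [set w | (X w <= x)%R]) (geometric_sum (q x) (K w))%:E)%E.

(** The factor by which the recursion feeds the tail of [H] back into itself; it
    tends to the mean of [K], because P(H <= x) tends to 1. *)
Definition truncated_mean x : R := fine (eM x).

Let eM_ge0 x : (0 <= eM x)%E.
Proof. by apply: integral_ge0 => w _; rewrite lee_fin geo_ge0. Qed.

Let eM_mono x y : x <= y -> (eM x <= eM y)%E.
Proof.
move=> xy; apply: (@le_trans _ _
    (\int[P]_(w in [set w | (X w <= x)%R]) (geometric_sum (q y) (K w))%:E)%E).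
  apply: ge0_le_integral => //.
  - by move=> w _; rewrite lee_fin geo_ge0.
  - exact/measurable_funTS/measurable_of_K.
  - exact/measurable_funTS/measurable_of_K.
  - by move=> w _; rewrite lee_fin geo_mono// q_mono.
apply: ge0_subset_integral => //.
- exact/measurable_funTS/measurable_of_K.
- by move=> w _; rewrite lee_fin geo_ge0.
- by move=> w /= Xx; exact: le_trans xy.
Qed.

Let eM_le x : (eM x <= m%:E)%E.
Proof.
rewrite -meanK; apply: (@le_trans _ _
    (\int[P]_(w in [set w | (X w <= x)%R]) ((K w)%:R : R)%:E)%E).
  apply: ge0_le_integral => //.
  - by move=> w _; rewrite lee_fin geo_ge0.
  - exact/measurable_funTS/measurable_of_K.
  - exact/measurable_funTS/(measurable_of_K (fun k => k%:R)).
  - by move=> w _; rewrite lee_fin -geo1 geo_mono.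
apply: ge0_subset_integral => //; exact: (measurable_of_K (fun k => k%:R)).
Qed.

Let eME x : eM x = (truncated_mean x)%:E.
Proof.
rewrite /truncated_mean fineK// ge0_fin_numE//.
exact: le_lt_trans (eM_le x) (ltry _).
Qed.

Lemma truncated_mean_le x : truncated_mean x <= m.
Proof. by rewrite -lee_fin -eME. Qed.

Lemma truncated_mean_mono x y : x <= y -> truncated_mean x <= truncated_mean y.
Proof. by move=> xy; rewrite -lee_fin -!eME eM_mono. Qed.

(** Subtracting the equation for q from P(X <= x) leaves the mean of 1 - q ^ K on
    the event X <= x, and 1 - q factors out of 1 - q ^ K.  The relation is exact,
    which makes the tails of [H] and [X] vanish at the same points. *)
Lemma tail_recursion x : G x * (1 - truncated_mean x) = p x.
Proof.
have G0 : 0 <= G x by exact: tail_ge0.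
have E1 : ((q x)%:E + (G x)%:E * eM x = P [set w | (X w <= x)%R])%E.
  rewrite {1}/q fineK ?fin_num_measure// cdfH.
  rewrite -(integral_nat_valued P (g := fun k => q x ^+ k) (mXle x) mK); last first.
    by move=> k; exact: exprn_ge0.
  rewrite -ge0_integralZl//; last 2 first.
  - exact/measurable_funTS/measurable_of_K.
  - by move=> w _; rewrite lee_fin geo_ge0.
  rewrite -ge0_integralD//.
  - rewrite -[RHS]mul1e -integral_cst//; apply: eq_integral => w _ /=.
    rewrite -EFinM -EFinD GE -[X in X * _]opprB mulNr -subrX1.
    by congr EFin; rewrite /q; ring.
  - by move=> w _; rewrite lee_fin exprn_ge0.
  - apply: measurable_funTS.
    exact: (measurable_of_K (fun k => fine (P [set w | (H w <= x%:E)%E]) ^+ k)).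
  - by move=> w _; rewrite -EFinM lee_fin mulr_ge0// geo_ge0.
  - by apply: measurable_funeM; exact/measurable_funTS/measurable_of_K.
move: E1; rewrite eME => /(congr1 fine) /= E1.
have : p x = 1 - fine (P [set w | (X w <= x)%R]).
  by rewrite /p tail_setC//; exact/measurable_EFinP.
rewrite -E1 => ->; rewrite GE; ring.
Qed.

(** This a priori bound forces the tail of [H] to 0; it takes the place of an
    argument for the almost sure extinction of the cluster. *)
Lemma tail_bound x : G x <= p x / (1 - m).
Proof.
have M1 : 0 < 1 - m by rewrite subr_gt0.
rewrite ler_pdivlMr// -tail_recursion ler_wpM2l// ?tail_ge0//.
by rewrite lerD2l lerN2 truncated_mean_le.
Qed.

Lemma max_tail_cvg0 : G x @[x --> +oo] --> (0 : R).
Proof.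
apply: (@squeeze_cvgr _ _ _ _ (fun=> 0) (fun x => p x / (1 - m))).
- by near=> x; rewrite tail_ge0 tail_bound.
- exact: cvg_cst.
- by rewrite -[X in _ --> X](mul0r (1 - m)^-1); apply: cvgMl; exact: tail_cvg0.
Unshelve. all: by end_near. Qed.

Lemma max_ae_fin :
  (forall w, (0 <= H w)%E) -> {ae P, forall w, H w \is a fin_num}.
Proof.
have mHy : measurable [set w | H w = +oo%E].
  rewrite -[X in measurable X]setTI.
  exact: (mH measurableT (emeasurable_set1 +oo%E)).
move=> H0; exists [set w | H w = +oo%E]; split.
- exact: mHy.
- apply/eqP; rewrite eq_le measure_ge0 andbT; apply/lee_addgt0Pr => e e0.
  have [x [_ /(_ (x + 1))]] := cvgr_lt _ max_tail_cvg0 _ e0.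
  rewrite ltrDl ltr01 => /(_ isT) Gx; rewrite add0e.
  apply: (@le_trans _ _ (G (x + 1))%:E); last by rewrite lee_fin ltW.
  rewrite /G tailE//; apply: le_measure; rewrite ?inE.
  + exact: mHy.
  + exact: measurable_gt.
  + by move=> w /= ->; exact: ltry.
- move=> w /=; have := H0 w; case: (H w) => //.
Qed.

Let geometric_sum_cvg k : geometric_sum (q n%:R) k @[n --> \oo] --> (k%:R : R).
Proof.
have qn1 : q n%:R @[n --> \oo] --> (1 : R).
  have -> : (fun n : nat => q n%:R) = (fun n => 1 - G n%:R).
    by apply/funext => n; rewrite GE opprB addrC subrK.
  rewrite -[X in _ --> X]subr0; apply: cvgB; first exact: cvg_cst.
  exact: (cvg_comp _ _ cvgr_idn max_tail_cvg0).
rewrite -geo1; apply: cvg_big => [|i _]; first exact: add_continuous.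
elim: (i : nat) => [|j IH]; first by under eq_fun do rewrite expr0; exact: cvg_cst.
by under eq_fun do rewrite exprS; rewrite exprS; exact: cvgM.
Qed.

Let eM_cvg : eM n%:R @[n --> \oo] --> m%:E.
Proof.
pose g (n : nat) := (fun w => (geometric_sum (q n%:R) (K w))%:E) \_ [set w | X w <= n%:R].
have -> : (fun n : nat => eM n%:R) = (fun n => (\int[P]_w g n w)%E).
  by apply/funext => n; rewrite /eM integral_mkcond.
rewrite -meanK.
have -> : (\int[P]_w ((K w)%:R : R)%:E = \int[P]_w limn (g^~ w))%E.
  apply: eq_integral => w _; apply/esym/cvg_lim => //.
  apply: (@cvg_trans _ ((geometric_sum (q n%:R) (K w))%:E @[n --> \oo])).
    apply: near_eq_cvg; near=> n; rewrite /g patchE mem_set//=.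
    by near: n; exact: nbhs_infty_ger.
  by apply: cvg_EFin; [near=> n|exact: geometric_sum_cvg].
apply: cvg_monotone_convergence => //.
- move=> n; apply: (iffLR (measurable_restrictT _ (mXle _))).
  exact/measurable_funTS/(measurable_of_K (geometric_sum (q n%:R))).
- by move=> n w _; rewrite /g patchE; case: ifPn => // _; rewrite lee_fin geo_ge0.
- move=> w _ n k nk; rewrite /g !patchE; case: ifPn => [/set_mem/= Xn|_].
    rewrite mem_set/=; last by rewrite (le_trans Xn)// ler_nat.
    by rewrite lee_fin geo_mono// q_mono// ler_nat.
  by case: ifPn => // _; rewrite lee_fin geo_ge0.
Unshelve. all: by end_near. Qed.

(** Monotone convergence along the integers, then monotonicity in between. *)
Lemma truncated_mean_cvg : truncated_mean x @[x --> +oo] --> m.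
Proof.
have /fine_cvg/cvgrPdist_lt Mn := eM_cvg.
apply/cvgrPdist_lt => e e0; have [N _ /(_ N (leqnn N))] := Mn _ e0.
rewrite /= -/(truncated_mean _) ger0_norm ?subr_ge0 ?truncated_mean_le// => MN.
near=> x; rewrite ger0_norm ?subr_ge0 ?truncated_mean_le//.
apply: le_lt_trans MN; rewrite lerD2l lerN2; apply: truncated_mean_mono.
by near: x; exact: nbhs_pinfty_ge.
Unshelve. all: by end_near. Qed.

(** Where the tails are positive the quotient is (1 - m) / (1 - truncated_mean x)
    by [tail_recursion], and where they vanish it is 1 by convention; as the
    former is at most 1, both cases lie between it and 1. *)
Lemma max_tail_asymp_equiv :
  asymp_equiv (tail P H) (fun x => 1 / (1 - m) * tail P (EFin \o X) x).
Proof.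
have m1 : 0 < 1 - m by rewrite subr_gt0.
apply: (@squeeze_cvgr _ _ _ _ (fun x => (1 - m) / (1 - truncated_mean x)) (fun=> 1)).
- near=> x.
  have M1 : 0 < 1 - truncated_mean x.
    by rewrite subr_gt0 (le_lt_trans (truncated_mean_le x)).
  have M2 : (1 - m) / (1 - truncated_mean x) <= 1.
    by rewrite ler_pdivrMr// mul1r lerD2l lerN2 truncated_mean_le.
  have := tail_recursion x; rewrite /G /p.
  case: ifPn; first by rewrite lexx andbT.
  move=> /nandP GP Gp.
  have G0 : tail P H x != 0.
    apply: contraPN GP => /eqP; rewrite -Gp => ->.
    by rewrite mul0r mulr0 eqxx => -[].
  rewrite -Gp (_ : _ / (_ * _) = (1 - m) / (1 - truncated_mean x)).
    by rewrite lexx M2.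
  by field; rewrite G0 (gt_eqF M1) (gt_eqF m1).
- rewrite -[X in _ --> X](@divff _ (1 - m)) ?gt_eqF//.
  apply: cvgM; first exact: cvg_cst.
  apply: cvgV; first by rewrite gt_eqF.
  by apply: cvgB; [exact: cvg_cst|exact: truncated_mean_cvg].
- exact: cvg_cst.
Unshelve. all: by end_near. Qed.

End max_recursion.
(** * Regularly varying tails *)

Section regular_tails.
Context (R : realType).
Implicit Types (r p : R -> R) (alpha t : R).

(** Regular variation at the level of the function x |-> P(Z > x); positivity
    everywhere follows from eventual positivity by monotonicity. *)
Definition regular_tail alpha r : Prop :=
  [/\ {homo r : x y /~ x <= y}, forall x, 0 < r x &
      forall t, 0 < t -> r (t * x) / r x @[x --> +oo] --> t `^ (- alpha)].

Lemma near_pinfty_scale t (Q : R -> Prop) : 0 < t ->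
  (\forall x \near +oo, Q x) -> \forall x \near +oo, Q (t * x).
Proof.
move=> t0 [M [_ MQ]]; exists (M / t); split; first by rewrite num_real.
by move=> x; rewrite ltr_pdivrMr// mulrC => /MQ.
Qed.

Lemma near_pinfty_unscale t (Q : R -> Prop) : 0 < t ->
  (\forall x \near +oo, Q (t * x)) -> \forall x \near +oo, Q x.
Proof.
move=> t0 /(@near_pinfty_scale t^-1 _); rewrite invr_gt0 => /(_ t0).
by apply: filterS => x; rewrite mulrA divff ?mul1r// gt_eqF.
Qed.

Lemma cvg_pinfty_scale t : 0 < t -> t * x @[x --> +oo] --> +oo.
Proof. by move=> t0 Q; exact: near_pinfty_scale. Qed.

Lemma regular_tail_of_eventually alpha r :
    {homo r : x y /~ x <= y} -> (\forall x \near +oo, 0 < r x) ->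
    (forall t, 0 < t -> r (t * x) / r x @[x --> +oo] --> t `^ (- alpha)) ->
  regular_tail alpha r.
Proof.
move=> mr [M [_ Mr]] rr; split => // x.
apply: (@lt_le_trans _ _ (r (Num.max x (M + 1)))).
  by apply: Mr; rewrite lt_max ltrDl ltr01 orbT.
by apply: mr; rewrite le_max lexx.
Qed.

Lemma regularly_varying_tail d (T : measurableType d) (P : probability T R)
    (Z : T -> \bar R) alpha :
  regularly_varying P Z alpha -> regular_tail alpha (tail P Z).
Proof.
move=> [a0 mZ _ _ [L [_ L0 LL] rL]].
apply: regular_tail_of_eventually; first exact: tail_nonincreasing.
  near=> x; rewrite rL; last by near: x; exact: nbhs_pinfty_gt.
  by rewrite mulr_gt0// ?powR_gt0//; near: x => //; exact: nbhs_pinfty_gt.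
move=> t t0; rewrite -[X in _ --> X]mulr1.
apply: cvg_trans; last exact: (cvgM (cvg_cst (t `^ (- alpha))) (LL t t0)).
apply: near_eq_cvg; near=> x.
have x0 : 0 < x by near: x; exact: nbhs_pinfty_gt.
have Lx : 0 < L x by near: x.
rewrite /= !rL ?mulr_gt0// powRM ?ltW//.
have : 0 < x `^ (- alpha) by rewrite powR_gt0.
move: (x `^ _) (t `^ _) => u v u0; field; by rewrite (gt_eqF Lx) (gt_eqF u0).
Unshelve. all: by end_near. Qed.

Lemma tail_regularly_varying d (T : measurableType d) (P : probability T R)
    (Z : T -> \bar R) alpha :
    0 < alpha -> measurable_fun [set: T] Z -> (forall w, (0 <= Z w)%E) ->
    {ae P, forall w, Z w \is a fin_num} ->
  regular_tail alpha (tail P Z) -> regularly_varying P Z alpha.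
Proof.
move=> a0 mZ Z0 Zfin [mr r0 rr]; split => //.
exists (fun x => x `^ alpha * tail P Z x); last first.
  move=> x x0; rewrite mulrA -powRD; last by rewrite (gt_eqF x0) implybT.
  by rewrite addNr powRr0 mul1r.
split.
- apply: measurable_funM.
    by apply: measurable_funTS; exact: measurable_powR.
  by apply: nonincreasing_measurable => // x y; exact: mr.
- near=> x; have x0 : 0 < x by near: x; exact: nbhs_pinfty_gt.
  by rewrite mulr_gt0 ?powR_gt0.
- move=> t t0.
  have -> : (1 : R) = t `^ alpha * t `^ (- alpha).
    by rewrite -powRD ?addrN ?powRr0// (gt_eqF t0) implybT.
  apply: cvg_trans; last exact: (cvgM (cvg_cst (t `^ alpha)) (rr t t0)).
  apply: near_eq_cvg; near=> x.
  have x0 : 0 < x by near: x; exact: nbhs_pinfty_gt.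
  rewrite /= powRM ?ltW//.
  have : 0 < x `^ alpha by rewrite powR_gt0.
  move: (x `^ _) (t `^ _) (r0 x) => u v rx u0; field.
  by rewrite (gt_eqF rx) (gt_eqF u0).
Unshelve. all: by end_near. Qed.

Lemma regular_tail_asymp_equiv alpha r (g : R -> R) (c : R) :
    regular_tail alpha r -> {homo g : x y /~ x <= y} -> 0 < c ->
    asymp_equiv g (fun x => c * r x) ->
  regular_tail alpha g.
Proof.
move=> [mr r0 rr] mg c0; rewrite /asymp_equiv.
under eq_fun do rewrite [c * _ == 0]gt_eqF ?mulr_gt0// andbF.
move=> gr.
have g0 : \forall x \near +oo, 0 < g x.
  apply: filterS (cvgr_gt _ gr 0 ltr01) => x.
  by rewrite pmulr_lgt0// invr_gt0 mulr_gt0.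
apply: regular_tail_of_eventually => // t t0.
have -> : t `^ (- alpha) = 1 * t `^ (- alpha) / 1 by rewrite mul1r divr1.
apply: cvg_trans; last first.
  apply: (cvgM (cvgM _ (rr t t0)) (cvgV (oner_neq0 R) gr)).
  exact: (cvg_comp _ _ (cvg_pinfty_scale t0) gr).
apply: near_eq_cvg; near=> x.
have gx : 0 < g x by near: x.
rewrite /=.
move: (r0 x) (r0 (t * x)) => rx rtx; field.
by rewrite (gt_eqF rx) (gt_eqF gx) (gt_eqF rtx) (gt_eqF c0).
Unshelve. all: by end_near. Qed.

(** For a quotient phi = p / r pinched, for every delta, between b and
    (1 + delta) b near infinity, with b depending on delta, the quotient
    phi(t x) / phi(x) tends to 1. *)
Lemma regular_tail_oscillation alpha r p :
    regular_tail alpha r -> {homo p : x y /~ x <= y} ->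
    (forall delta, 0 < delta -> exists2 b, 0 < b & \forall x \near +oo,
       b <= p x / r x <= (1 + delta) * b) ->
  regular_tail alpha p.
Proof.
move=> [mr r0 rr] mp osc.
have p0 : \forall x \near +oo, 0 < p x.
  have [b b0 bp] := osc 1 ltr01.
  near=> x; have /andP[+ _] : b <= p x / r x <= (1 + 1) * b by near: x.
  by rewrite ler_pdivlMr//; apply: lt_le_trans; rewrite mulr_gt0.
apply: regular_tail_of_eventually => // t t0.
pose phi x := p x / r x.
have ratio : phi (t * x) / phi x @[x --> +oo] --> (1 : R).
  apply/cvgrPdist_le => e e0; have [b b0 bp] := osc e e0.
  near=> x.
  have /andP[px1 px2] : b <= phi x <= (1 + e) * b by near: x.
  have /andP[pt1 pt2] : b <= phi (t * x) <= (1 + e) * b.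
    by near: x; exact: (near_pinfty_scale t0 bp).
  have px : 0 < phi x by exact: lt_le_trans b0 px1.
  rewrite ler_distlC ler_pdivlMr// ler_pdivrMr//; apply/andP; split.
    apply: le_trans pt1; have [e1|e1] := leP 1 e.
      by apply: le_trans (ltW b0); rewrite mulr_le0_ge0 ?subr_le0// ltW.
    apply: (@le_trans _ _ ((1 - e) * ((1 + e) * b))).
      by rewrite ler_wpM2l// subr_ge0 ltW.
    by nra.
  apply: (le_trans pt2); rewrite ler_wpM2l//.
  by rewrite addr_ge0// ltW.
rewrite -[X in _ --> X]mul1r.
apply: cvg_trans; last exact: (cvgM ratio (rr t t0)).
apply: near_eq_cvg; near=> x.
have px : 0 < p x by near: x.
rewrite /= /phi.
move: (r0 x) (r0 (t * x)) => rx rtx; field.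
by rewrite (gt_eqF rx) (gt_eqF px) (gt_eqF rtx).
Unshelve. all: by end_near. Qed.

End regular_tails.

Section tail_comparison.
Context (R : realType) (alpha : R) (r p : R -> R) (a : nat -> R).
Hypotheses (alpha_gt0 : 0 < alpha) (r_reg : regular_tail alpha r)
  (r_cvg0 : r x @[x --> +oo] --> (0 : R)) (mp : {homo p : x y /~ x <= y})
  (ra : n%:R * r (a n) @[n --> \oo] --> (1 : R)).

Let r0 x : 0 < r x. Proof. by have [] := r_reg. Qed.
Let mr : {homo r : x y /~ x <= y}. Proof. by have [] := r_reg. Qed.

(** [N x] is the index n for which a_n is close to x, since n r(a_n) and
    [N x * r x] both tend to 1. *)
Let N x : nat := (Num.truncn (r x)^-1).+1.

Let N_gt x : (r x)^-1 < (N x)%:R.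
Proof. by rewrite truncnS_gt. Qed.

Let N_le x : (N x)%:R <= (r x)^-1 + 1.
Proof. by rewrite /N -natr1 lerD2r truncn_le ltW ?invr_gt0. Qed.

Let N_cvg : N x @[x --> +oo] --> \oo.
Proof.
move=> Q [k _ kQ].
have : \forall x \near +oo, r x < k.+1%:R^-1.
  by apply: (cvgr_lt _ r_cvg0); rewrite invr_gt0.
apply: filterS => x rx; apply: kQ => /=; rewrite -(ler_nat R) ltW//.
apply: lt_trans (N_gt x); apply: (@lt_le_trans _ _ k.+1%:R).
  by rewrite ltr_nat.
by rewrite -[leLHS]invrK lef_pV2 ?posrE ?invr_gt0// ltW.
Qed.

Let Nr_cvg t : 0 < t -> (N x)%:R * r (t * x) @[x --> +oo] --> t `^ (- alpha).
Proof.
move=> t0; have [_ _ /(_ t t0) rt] := r_reg.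
have N1 : (N x)%:R * r x @[x --> +oo] --> (1 : R).
  apply: (@squeeze_cvgr _ _ _ _ (fun=> 1) (fun x => 1 + r x)).
  - near=> x; rewrite -!ler_pdivrMr// mul1r ltW//=.
    by rewrite -ler_pdivlMr// mulrDl mul1r divff ?gt_eqF.
  - exact: cvg_cst.
  - by rewrite -[X in _ --> X]addr0; apply: cvgD; [exact: cvg_cst|].
rewrite -[X in _ --> X]mul1r.
apply: cvg_trans; last exact: (cvgM N1 rt).
apply: near_eq_cvg; near=> x.
by rewrite /= mulrACA divff ?mulr1// gt_eqF.
Unshelve. all: by end_near. Qed.

Let Na_cvg : (N x)%:R * r (a (N x)) @[x --> +oo] --> (1 : R).
Proof. exact: (cvg_comp _ _ N_cvg ra). Qed.

Let powR_gt1 (x s : R) : 1 < x -> 0 < s -> 1 < x `^ s.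
Proof.
move=> x1 s0; rewrite -(congr1 (@^~ s) (powR1 R)).
by apply: gt0_ltr_powR => //; rewrite nnegrE// ltW// (lt_trans ltr01).
Qed.

(** As [r] is monotone, the failure of this bound or of the next would contradict
    the limits 1 of [N x * r (a (N x))] and t ^ (- alpha) of [N x * r (t * x)]. *)
Let a_lt (lambda : R) : 1 < lambda -> \forall x \near +oo, a (N x) < lambda * x.
Proof.
move=> l1; have l0 : 0 < lambda by rewrite (lt_trans ltr01).
have := cvgr_gt _ (cvgB Na_cvg (Nr_cvg l0)) 0.
rewrite subr_gt0 powRN invf_lt1 ?powR_gt0// powR_gt1// => /(_ _ _ isT).
apply: filterS => x; rewrite !fctE subr_gt0 ltr_pM2l ?ltr0n// => rx.
by rewrite ltNge; apply: contraL rx => ax; rewrite -leNgt mr.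
Qed.

Let a_gt (lambda : R) : 1 < lambda -> \forall x \near +oo, lambda^-1 * x < a (N x).
Proof.
move=> l1; have l0 : 0 < lambda by rewrite (lt_trans ltr01).
have l0' : 0 < lambda^-1 by rewrite invr_gt0.
have := cvgr_gt _ (cvgB (Nr_cvg l0') Na_cvg) 0.
rewrite subr_gt0 -powR_inv1 ?ltW// -powRrM mulN1r opprK powR_gt1// => /(_ _ _ isT).
apply: filterS => x; rewrite !fctE subr_gt0 ltr_pM2l ?ltr0n// powR_inv1 ?ltW// => rx.
by rewrite ltNge; apply: contraL rx => ax; rewrite -leNgt mr.
Qed.

(** Taking n = [N x], the hypothesis bounds p(x / lambda) from below and
    p(lambda ^ 2 x) from above by u_n / n, that is by J r(x) asymptotically.
    Moving the arguments to a common point costs the factors lambda ^ alpha and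
    lambda ^ (2 alpha), and passing from limits to eventual inequalities one
    factor lambda on each side, so that the bounds on p / r differ by the factor
    lambda ^ (3 alpha + 2), which is as close to 1 as desired. *)
Lemma regular_tail_compare :
    (forall lambda : R, 1 < lambda -> exists (J : R) (u : nat -> R),
      [/\ 0 < J, u n @[n --> \oo] --> J & \forall n \near \oo,
          n%:R * p (lambda * a n) <= u n <= n%:R * p (a n)]) ->
  regular_tail alpha p.
Proof.
move=> approx; apply: (regular_tail_oscillation r_reg mp) => delta delta0.
(* The exponent makes lambda ^ (3 alpha + 2) equal to 1 + delta. *)
pose lambda := (1 + delta) `^ (3 * alpha + 2)^-1.
have l1 : 1 < lambda.
  by rewrite powR_gt1 ?ltrDl// invr_gt0 addr_gt0// mulr_gt0.
have l0 : 0 < lambda by rewrite (lt_trans ltr01).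
pose A := lambda `^ alpha.
have A0 : 0 < A by rewrite powR_gt0.
have Al : A ^+ 3 * lambda ^+ 2 = 1 + delta.
  rewrite -!powR_mulrn ?ltW// /A -powRrM -powRD; last by rewrite (gt_eqF l0) implybT.
  rewrite /lambda -powRrM [alpha * _]mulrC mulVf ?powRr1 ?gt_eqF ?addr_gt0 ?mulr_gt0//.
  by rewrite addr_ge0// ltW.
have [J [u [J0 uJ up]]] := approx _ l1.
have uN : u (N x) @[x --> +oo] --> J by exact: (cvg_comp _ _ N_cvg uJ).
have upN : \forall x \near +oo,
    (N x)%:R * p (lambda * a (N x)) <= u (N x) <= (N x)%:R * p (a (N x)).
  exact: N_cvg up.
have ly : 0 < lambda^-1 by rewrite invr_gt0.
have ll : 0 < lambda * lambda by rewrite mulr_gt0.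
have lower : \forall x \near +oo,
    J / (A * lambda) <= p (lambda^-1 * x) / r (lambda^-1 * x).
  have lA : (lambda^-1) `^ (- alpha) = A.
    by rewrite -(powR_inv1 (ltW l0)) -powRrM mulN1r opprK.
  have lim : u (N x) / ((N x)%:R * r (lambda^-1 * x)) @[x --> +oo] --> J / A.
    by rewrite -lA; apply: cvgM => //; apply: cvgV; [rewrite lA gt_eqF|exact: Nr_cvg].
  have JA : J / (A * lambda) < J / A.
    by rewrite ltr_pM2l// ltf_pV2 ?posrE ?mulr_gt0// ltr_pMr.
  near=> x; apply: (@le_trans _ _ (u (N x) / ((N x)%:R * r (lambda^-1 * x)))).
    by apply: ltW; near: x; exact: (cvgr_gt _ lim).
  rewrite ler_pdivrMr ?mulr_gt0// mulrCA divfK ?gt_eqF//.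
  have /andP[_ up2] : (N x)%:R * p (lambda * a (N x)) <= u (N x) <= (N x)%:R * p (a (N x)).
    by near: x.
  apply: (le_trans up2); rewrite ler_pM2l//; apply: mp; apply: ltW.
  by near: x; exact: a_gt.
have upper : \forall x \near +oo, p (lambda * lambda * x) / r (lambda * lambda * x)
    <= (1 + delta) * (J / (A * lambda)).
  have lA : (lambda * lambda) `^ (- alpha) = (A * A)^-1.
    by rewrite powRN powRM ?ltW.
  have lim : u (N x) / ((N x)%:R * r (lambda * lambda * x)) @[x --> +oo] --> J * (A * A).
    rewrite -[A * A]invrK -lA; apply: cvgM => //.
    by apply: cvgV; [rewrite lA invr_eq0 gt_eqF ?mulr_gt0|exact: Nr_cvg].
  have JA : J * (A * A) < (1 + delta) * (J / (A * lambda)).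
    have -> : (1 + delta) * (J / (A * lambda)) = J * (A * A) * lambda.
      by rewrite -Al; field; rewrite (gt_eqF A0) (gt_eqF l0).
    by rewrite ltr_pMr ?mulr_gt0.
  near=> x; apply: (@le_trans _ _ (u (N x) / ((N x)%:R * r (lambda * lambda * x)))).
    rewrite ler_pdivlMr ?mulr_gt0// mulrCA divfK ?gt_eqF//.
    have /andP[up1 _] : (N x)%:R * p (lambda * a (N x)) <= u (N x) <= (N x)%:R * p (a (N x)).
      by near: x.
    apply: le_trans up1; rewrite ler_pM2l//; apply: mp.
    rewrite -mulrA ler_pM2l//; apply: ltW.
    by near: x; exact: a_lt.
  by apply: ltW; near: x; exact: (cvgr_lt _ lim).
exists (J / (A * lambda)); first by rewrite divr_gt0// mulr_gt0.
have lower' : \forall x \near +oo, J / (A * lambda) <= p x / r x.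
  exact: near_pinfty_unscale ly lower.
have upper' : \forall x \near +oo, p x / r x <= (1 + delta) * (J / (A * lambda)).
  exact: near_pinfty_unscale ll upper.
by near=> x; apply/andP; split; near: x.
Unshelve. all: by end_near. Qed.

End tail_comparison.

(** * From vague convergence to the tail of the first coordinate *)

Section first_coordinate.
Context (R : realType).

Definition ramp (lambda y : R) : R :=
  Num.min 1 (Num.max 0 ((y - 1) / (lambda - 1))).

Lemma ramp_ge0 lambda y : 0 <= ramp lambda y.
Proof. by rewrite /ramp le_min ler01 le_max lexx. Qed.

Lemma ramp_le1 lambda y : ramp lambda y <= 1.
Proof. by rewrite /ramp ge_min lexx. Qed.

Lemma ramp_gt0 lambda y : 1 < lambda -> (0 < ramp lambda y) = (1 < y).
Proof.
move=> l1; rewrite /ramp lt_min ltr01 lt_max ltxx /=.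
by rewrite pmulr_lgt0 ?invr_gt0 subr_gt0.
Qed.

Lemma ramp_eq1 lambda y : 1 < lambda -> lambda <= y -> ramp lambda y = 1.
Proof.
move=> l1 ly; apply/min_idPl; rewrite le_max; apply/orP; right.
by rewrite ler_pdivlMr ?subr_gt0// mul1r lerD2r.
Qed.

Lemma continuous_ramp lambda : continuous (ramp lambda).
Proof.
move=> y.
have cy : {for y, continuous (fun y : R => (y - 1) / (lambda - 1))}.
  by apply: cvgMl; apply: cvgB; [exact: cvg_id|exact: cvg_cst].
have c0 : {for y, continuous (cst 0 : R -> R)} by exact: cvg_cst.
have c1 : {for y, continuous (cst 1 : R -> R)} by exact: cvg_cst.
exact: (continuous_min c1 (continuous_max c0 cy)).
Qed.

Lemma vague_test_ramp lambda : 1 < lambda ->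
  vague_test (fun z : R * R => ramp lambda z.1).
Proof.
move=> l1; split.
- move=> z; apply: continuous_comp; first exact: cvg_fst.
  exact: continuous_ramp.
- by move=> z; exact: ramp_ge0.
- by exists 1 => z; exact: ramp_le1.
- exists 1 => // z /= z0; have : 0 < ramp lambda z.1 by rewrite lt0r z0 ramp_ge0.
  rewrite ramp_gt0// => z1.
  rewrite prod_normE le_max (le_trans (ltW z1))//; exact: ler_norm.
Qed.

Lemma measurable_ramp_fst lambda :
  measurable_fun [set: R * R] (fun z : R * R => (ramp lambda z.1)%:E).
Proof.
apply/measurable_EFinP; apply: (measurableT_comp (f := ramp lambda)) => //.
by apply: continuous_measurable_fun; exact: continuous_ramp.
Qed.

(** The ramp is supported in x_1 >= 1, which is bounded away from the origin, and
    is positive exactly where x_1 > 1. *)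
Lemma ramp_integral (mu : {measure set (R * R) -> \bar R}) lambda :
    1 < lambda ->
    (forall B, measurable B -> bounded_away B -> (mu B < +oo)%E) ->
    (0 < mu [set z | (1 < z.1)%R])%E ->
  exists2 J, 0 < J & (\int[mu]_z (ramp lambda z.1)%:E = J%:E)%E.
Proof.
move=> l1 mufin mupos.
pose B : set (R * R) := [set z | 1 < z.1].
have mB : measurable B.
  rewrite (_ : B = fst @^-1` `]1, +oo[).
    by rewrite -[X in measurable X]setTI; exact: measurable_fst.
  by apply/seteqP; split => z /=; rewrite in_itv/= andbT.
have I0 : (0 <= \int[mu]_z (ramp lambda z.1)%:E)%E.
  by apply: integral_ge0 => z _; rewrite lee_fin ramp_ge0.
have Ifin : (\int[mu]_z (ramp lambda z.1)%:E < +oo)%E.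
  apply: (@le_lt_trans _ _ (\int[mu]_z (\1_B z)%:E)%E).
    apply: ge0_le_integral => //.
    - by move=> z _; rewrite lee_fin ramp_ge0.
    - exact: measurable_ramp_fst.
    - by apply/measurable_EFinP; exact: measurable_indic.
    - move=> z _; rewrite lee_fin indicE; have [|zB] := boolP (z \in B).
        by rewrite ramp_le1.
      rewrite leNgt ramp_gt0//; apply: contra zB => z1; exact/mem_set.
  rewrite integral_indic// setIT; apply: mufin => //.
  exists 1 => // z z1; rewrite prod_normE le_max (le_trans (ltW z1))//.
  exact: ler_norm.
exists (fine (\int[mu]_z (ramp lambda z.1)%:E)%E); last by rewrite fineK// ge0_fin_numE.
rewrite fine_gt0// Ifin andbT lt_neqAle I0 andbT eq_sym.
apply: contraTneq mupos => Ieq0; rewrite -leNgt.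
have /ae_eq_integral_abs : measurable_fun setT (fun z : R * R => (ramp lambda z.1)%:E).
  exact: measurable_ramp_fst.
move=> /(_ mu measurableT) [+ _].
under eq_integral do rewrite gee0_abs ?lee_fin ?ramp_ge0//.
move=> /(_ Ieq0) [C [mC C0 BC]].
rewrite -C0; apply: le_measure; rewrite ?inE// => z z1; apply: BC => /= /(_ I) [] z0.
by have := z1; rewrite /= -(ramp_gt0 _ l1) z0 ltxx.
Qed.

(** The ramp lies between the indicators of the half-planes x_1 > lambda and
    x_1 > 1, so that its mean at V / a_n lies between P(X > lambda a_n) and
    P(X > a_n). *)
Lemma regular_tail_first_coordinate d (T : measurableType d)
    (P : probability T R) (X Y : T -> R) alpha
    (mu : {measure set (R * R) -> \bar R}) :
    measurable_fun [set: T] X -> measurable_fun [set: T] Y ->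
    regularly_varying_vector P (fun w => (X w, Y w)) alpha mu ->
    (0 < mu [set z | (1 < z.1)%R])%E ->
  regular_tail alpha (tail P (EFin \o X)).
Proof.
move=> mX mY [mV [_ mufin _] [N [a [_ rvN Na vague]]]] mupos.
have r_reg := regularly_varying_tail rvN.
have [alpha0 mN _ _ _] := rvN.
have mN' : measurable_fun setT (fun w => N (X w, Y w)) by exact/measurable_EFinP.
apply: (regular_tail_compare alpha0 r_reg (tail_cvg0 P mN') _ Na).
  exact/tail_nonincreasing/measurable_EFinP.
move=> lambda l1; have [J J0 JE] := ramp_integral l1 mufin mupos.
have [_ r0 _] := r_reg.
(* n r(a_n) tends to 1, whereas n r(0) is unbounded, so a_n <= 0 is excluded. *)
have a0 : \forall n \near \oo, 0 < a n.
  have n1 : \forall n \near \oo, n%:R * tail P (fun w => (N (X w, Y w))%:E) (a n) < 2.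
    by apply: (cvgr_lt _ Na); rewrite ltr1n.
  near=> n; rewrite ltNge; apply/negP => an.
  have : n%:R * tail P (fun w => (N (X w, Y w))%:E) (a n) < 2 by near: n.
  apply/negP; rewrite -leNgt.
  apply: (@le_trans _ _ (n%:R * tail P (fun w => (N (X w, Y w))%:E) 0)).
    by rewrite -ler_pdivrMr//; near: n; exact: nbhs_infty_ger.
  by rewrite ler_wpM2l//; apply: tail_nonincreasing.
pose I n : \bar R := (\int[P]_w (ramp lambda ((a n)^-1 * X w))%:E)%E.
have mB x : measurable [set w | x < X w].
  rewrite (_ : [set w | x < X w] = X @^-1` `]x, +oo[).
    by rewrite -[Y in measurable Y]setTI; exact: mX.
  by apply/seteqP; split => w /=; rewrite in_itv/= andbT.
have mI n : measurable_fun setT (fun w => (ramp lambda ((a n)^-1 * X w))%:E).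
  apply/measurable_EFinP; apply: (measurableT_comp (f := ramp lambda)).
    by apply: continuous_measurable_fun; exact: continuous_ramp.
  exact: measurable_funM.
have tailI x : (tail P (EFin \o X) x)%:E = (\int[P]_w (\1_[set w | x < X w] w)%:E)%E.
  by rewrite integral_indic// setIT tailE//; exact/measurable_EFinP.
exists J, (fun n => fine (n%:R%:E * I n)%E); split => //.
  by apply: fine_cvg; rewrite -JE; apply: vague; exact: vague_test_ramp.
near=> n; have an : 0 < a n by near: n.
have lo : ((tail P (EFin \o X) (lambda * a n))%:E <= I n)%E.
  rewrite tailI; apply: ge0_le_integral => //.
  - by apply/measurable_EFinP; exact: measurable_indic.
  - move=> w _; rewrite lee_fin indicE.
    have [/set_mem/= Xw|_] := boolP (w \in _); last exact: ramp_ge0.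
    by rewrite ramp_eq1// mulrC ler_pdivlMr// ltW.
have hi : (I n <= (tail P (EFin \o X) (a n))%:E)%E.
  rewrite tailI; apply: ge0_le_integral => //.
  - by move=> w _; rewrite lee_fin ramp_ge0.
  - by apply/measurable_EFinP; exact: measurable_indic.
  - move=> w _; rewrite lee_fin indicE.
    have [_|wB] := boolP (w \in _); first exact: ramp_le1.
    rewrite leNgt ramp_gt0//; apply: contra wB.
    by rewrite mulrC ltr_pdivlMr// mul1r => Xw; exact/mem_set.
have Ifin : I n \is a fin_num.
  rewrite fin_numE -leye_eq -leeNy_eq -!ltNge (lt_le_trans _ lo) ?ltNyr//.
  by rewrite (le_lt_trans hi) ?ltry.
move: lo hi; rewrite -(fineK Ifin) !lee_fin => lo hi.
by rewrite /= !ler_wpM2l.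
Unshelve. all: by end_near. Qed.

End first_coordinate.

(** * The tail of the cluster maximum *)

Unset Implicit Arguments.

Theorem proposition6p1 (R : realType)
  (dA : measure_display) (A : measurableType dA) (F : probability A R)
  (f : A -> R) (h : R * A -> R)
  (f_meas : measurable_fun [set: A] f) (f_ge0 : forall a, 0 <= f a)
  (h_meas : measurable_fun ((`]0, +oo[ : set R) `*` [set: A]) h)
  (h_ge0 : forall t a, 0 < t -> 0 <= h (t, a))
  (dT : measure_display) (T : measurableType dT) (P : probability T R)
  (mark : seq nat -> T -> A) (nchild : seq nat -> T -> nat)
  (cluster : hawkes_cluster F h P mark nchild)
  (alpha : R) (mu : {measure set (R * R) -> \bar R}) :
  let X : T -> R := fun w => f (mark [::] w) in
  let kappaA : T -> \bar R := fun w => kappa h (mark [::] w) in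
  let LA : T -> nat := nchild [::] in
  let Ekappa : \bar R := (\int[P]_w kappaA w)%E in
  let HH : T -> \bar R := cluster_max f mark nchild in
  1 < alpha ->
  regularly_varying_vector P (fun w => (X w, fine (kappaA w))) alpha mu ->
  (Ekappa < 1)%E ->
  [/\ max_fixed_point P X LA HH,
      asymp_equiv (tail P HH)
        (fun x => 1 / (1 - fine Ekappa) * tail P (fun w => (X w)%:E) x) &
      (0 < mu [set x | [/\ 0 <= x.1, 0 <= x.2, x != 0 & 1 < x.1]%R])%E ->
      regularly_varying P HH alpha].
Proof.
move=> X kappaA LA Ekappa HH alpha1 rvV Ek1.
have mmark := measurable_mark cluster [::].
have mX : measurable_fun setT X by exact: (measurableT_comp f_meas mmark).
have mL : measurable_fun setT LA := measurable_nchild cluster [::].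
have mHH : measurable_fun setT HH := measurable_cluster_max cluster f_meas.
have EkF : Ekappa = (\int[F]_a kappa h a)%E.
  exact: (integral_kappa_mark cluster h_meas h_ge0).
have Ekm : Ekappa = (fine Ekappa)%:E.
  rewrite fineK// ge0_fin_numE ?(lt_trans Ek1) ?ltry//.
  by rewrite EkF; apply: integral_ge0 => a _; exact: kappa_ge0.
have m1 : fine Ekappa < 1 by rewrite -lte_fin -Ekm.
have meanL : (\int[P]_w ((LA w)%:R : R)%:E = (fine Ekappa)%:E)%E.
  rewrite (expected_nchild cluster h_meas h_ge0) -EkF//.
  exact: lt_trans Ek1 (ltry _).
have cdf := cluster_max_cdf cluster f_meas.
have equiv := max_tail_asymp_equiv mX mL mHH cdf meanL m1.
split=> //; first exact: (cluster_max_fixed_point cluster f_meas).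
move=> mupos.
have HH0 w : (0 <= HH w)%E.
  apply: (@le_trans _ _ (X w)%:E); first by rewrite lee_fin f_ge0.
  by apply: ereal_sup_ubound; exists [::] => //; exact: in_cluster_root.
have mk : measurable_fun setT (fun w => fine (kappaA w)).
  apply: (measurableT_comp (f := fine)) => //.
  exact: (measurableT_comp (measurable_kappa h_meas h_ge0) mmark).
have mu1 : (0 < mu [set z | (1 < z.1)%R])%E.
  apply: (lt_le_trans mupos); apply: le_measure; rewrite ?inE.
  - rewrite (_ : [set _ | _] = `]1, +oo[ `*` `[0, +oo[).
      exact: measurableX.
    apply/seteqP; split => [[x y] /=|[x y] /=]; rewrite !in_itv/= !andbT.
      by case=> _ -> _ ->.
    move=> [x1 y0]; split => //; first by rewrite (le_trans _ (ltW x1)).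
    by apply: contraTneq x1 => -[-> _]; rewrite ltr10.
  - rewrite (_ : [set _ | _] = `]1, +oo[ `*` setT); first exact: measurableX.
    by apply/seteqP; split => [[x y] /=|[x y] /=]; rewrite in_itv/= andbT; [|case].
  - by move=> z [].
apply: tail_regularly_varying => //; first exact: lt_trans ltr01 alpha1.
  exact: (max_ae_fin mX mL mHH cdf meanL m1).
apply: regular_tail_asymp_equiv equiv.
- exact: regular_tail_first_coordinate mX mk rvV mu1.
- exact: tail_nonincreasing.
- by rewrite divr_gt0// subr_gt0.
Qed.
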